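(* Let $k$ be a perfect field of characteristic two, let $r\in k\setminus\mathrm{AS}(k)$ be fixed, and let $\mathcal{N}=k^*\times\big((k\times k)\setminus\{(0,0)\}\big)\times(k/\mathrm{AS}(k))$. For $(a,b,c,d)\in\mathcal{N}$ let $C^r_{abcd}$ be the smooth projective curve of genus two over $k$ with quasi-affine model $y^2+y=ax+\frac{bx+c}{x^2+x+r}+d$. Let $\Gamma=\{x,\,1+x\}\subseteq\mathrm{PGL}_2(k)$, a group isomorphic to $C_2$, acting on $\mathcal{N}$ by $$(a,b,c,d)^\gamma=\begin{cases}(a,b,c,d)&\text{if }\gamma(x)=x,\\ (a,b,b+c,d+a)&\text{if }\gamma(x)=1+x.\end{cases}$$ 1. For any $(a,b,c,d),(a',b',c',d')\in\mathcal{N}$, the curves $C^r_{a'b'c'd'}$ and $C^r_{abcd}$ are $k$-isomorphic if and only if $(a',b',c',d')=(a,b,c,d)^\gamma$ for some $\gamma\in\Gamma$. 2. For any $(a,b,c,d)\in\mathcal{N}$ there is a split exact sequence $$1\to\langle\iota\rangle\to\mathrm{Aut}_k(C^r_{abcd})\to\Gamma_{abcd}\to1,$$ where $\Gamma_{abcd}$ is the isotropy group of $(a,b,c,d)$ under the action of $\Gamma$, and $\Gamma_{abcd}\simeq C_2$ if $b=0$ and $a\in\mathrm{AS}(k)$, while $\Gamma_{abcd}$ is trivial otherwise.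
   Context: $\mathrm{AS}(k)=\{x+x^2 : x\in k\}$. The fourth coordinate $d$ of an element of $\mathcal{N}$ is a class in $k/\mathrm{AS}(k)$; in the equation of the curve one uses any representative in $k$, which does not change the $k$-isomorphism class, and comparisons of fourth coordinates are in $k/\mathrm{AS}(k)$. Elements of $\mathrm{PGL}_2(k)$ are written as fractional linear transformations $\gamma(x)$ of $\mathbb{P}^1$. The hyperelliptic involution is $\iota\colon(x,y)\mapsto(x,y+1)$. Every $k$-automorphism of such a curve has the form $(x,y)\mapsto(\gamma(x),y+v(x))$ with $\gamma\in\mathrm{PGL}_2(k)$, $v(x)\in k(x)$, and the right-hand map of the exact sequence sends it to $\gamma$. $C_2$ denotes the cyclic group of order 2. *)

(* Defs.v *)
From HB Require Import structures.
From mathcomp Require Import all_boot all_order all_algebra all_fingroup.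
From mathcomp Require Import qfpoly generic_quotient ring_quotient fraction.
From mathcomp Require Import boolp classical_sets functions topology_structure.
From mathcomp Require Import ring zify.

Set Implicit Arguments.
Unset Strict Implicit.
Unset Printing Implicit Defensive.

Import GRing.Theory.
Local Open Scope ring_scope.
Local Open Scope quotient_scope.
Local Open Scope classical_set_scope.

Notation "x %:F" := (FracField.tofrac x) : ring_scope.

Definition perfect_field (k : fieldType) : Prop :=
  forall p : nat, p \in [pchar k] -> forall x : k, exists y : k, y ^+ p = x.

Section ArtinSchreier.
Context {k : fieldType} (k2 : 2%N \in [pchar k]).

(* The proof [k2] is a parameter because AS(k) is a subgroup of k only in
   characteristic two. *)
Definition AS (z : k) : bool := let _ := k2 in `[< exists x : k, z = x + x ^+ 2 >].

Lemma ASP z : reflect (exists x : k, z = x + x ^+ 2) (AS z).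
Proof. exact: asboolP. Qed.

Lemma AS_zmod_closed : zmod_closed AS.
Proof.
split=> [|u v /ASP[x ->] /ASP[y ->]].
  by apply/ASP; exists 0; rewrite expr2 mul0r addr0.
apply/ASP; exists (x - y); rewrite sqrrB -mulr_natr (pcharf0 k2) mulr0 subr0.
by rewrite opprD addrACA (oppr_pchar2 k2 (y ^+ 2)).
Qed.

HB.instance Definition _ := GRing.isZmodClosed.Build k AS AS_zmod_closed.

Definition AS_subgroup := GRing.ZmodClosed.clone k AS _.
Definition kAS := Quotient.quot AS_subgroup.
HB.instance Definition _ := GRing.Zmodule.on kAS.
HB.instance Definition _ : EqQuotient k (Quotient.equiv AS_subgroup) kAS := EqQuotient.on kAS.

Definition AS_class (d : k) : kAS := \pi_kAS d.

Lemma AS_classD : {morph AS_class : x y / x + y}.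
Proof. exact: (raddfD (\pi_kAS)). Qed.

Lemma AS_class_eq d e : (AS_class d = AS_class e) <-> AS (d - e).
Proof.
split=> [/eqP|h]; last apply/eqP.
  by rewrite -(Quotient.idealrBE AS_subgroup).
by rewrite -(Quotient.idealrBE AS_subgroup).
Qed.

End ArtinSchreier.

Section PGL2.
Variable k : fieldType.

Record GL2 := GL2Of { GL2_mx :> 'M[k]_2; _ : GL2_mx \in unitmx }.
HB.instance Definition _ := [isSub for GL2_mx].
HB.instance Definition _ := [Choice of GL2 by <:].

Lemma GL2_unit (A : GL2) : (A : 'M_2) \in unitmx. Proof. by case: A. Qed.

Fact GL2_mulP (A B : GL2) : (A : 'M_2) *m B \in unitmx.
Proof. by rewrite unitmx_mul !GL2_unit. Qed.
Fact GL2_invP (A : GL2) : invmx A \in unitmx.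
Proof. by rewrite unitmx_inv GL2_unit. Qed.
Definition GL2_one := GL2Of (unitmx1 k 2).
Definition GL2_mul A B := GL2Of (GL2_mulP A B).
Definition GL2_inv A := GL2Of (GL2_invP A).

Fact GL2_mulA : associative GL2_mul.
Proof. by move=> A B C; apply/val_inj/mulmxA. Qed.
Fact GL2_mul1 : left_id GL2_one GL2_mul.
Proof. by move=> A; apply/val_inj/mul1mx. Qed.
Fact GL2_mulr1 : right_id GL2_one GL2_mul.
Proof. by move=> A; apply/val_inj/mulmx1. Qed.
Fact GL2_mulV : left_inverse GL2_one GL2_inv GL2_mul.
Proof. by move=> A; apply/val_inj/mulVmx/GL2_unit. Qed.
Fact GL2_mulrV : right_inverse GL2_one GL2_inv GL2_mul.
Proof. by move=> A; apply/val_inj/mulmxV/GL2_unit. Qed.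
HB.instance Definition _ :=
  isGroup.Build GL2 GL2_mulA GL2_mul1 GL2_mulr1 GL2_mulV GL2_mulrV.

Definition proportional (A B : GL2) : bool :=
  `[< exists2 c : k, c != 0 & (A : 'M_2) = c *: (B : 'M_2) >].

Fact proportional_refl : reflexive proportional.
Proof. by move=> A; apply/asboolP; exists 1; rewrite ?oner_eq0 ?scale1r. Qed.
Fact proportional_sym : symmetric proportional.
Proof.
suff H A B : proportional A B -> proportional B A.
  by move=> A B; apply/idP/idP; exact: H.
move/asboolP=> [c c0 e]; apply/asboolP; exists c^-1; first by rewrite invr_eq0.
by rewrite e scalerA mulVf ?scale1r.
Qed.
Fact proportional_trans : transitive proportional.
Proof.
move=> B A C /asboolP[c c0 e] /asboolP[d d0 f]; apply/asboolP; exists (c * d).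
  by rewrite mulf_neq0.
by rewrite e f scalerA.
Qed.
Canonical proportional_equiv :=
  EquivRel proportional proportional_refl proportional_sym proportional_trans.

Definition PGL2 := {eq_quot proportional}.
HB.instance Definition _ : EqQuotient GL2 proportional PGL2 := EqQuotient.on PGL2.
HB.instance Definition _ := Choice.on PGL2.

Definition PGL2_class (A : GL2) : PGL2 := \pi_PGL2 A.

Lemma PGL2_classP (A B : GL2) :
  PGL2_class A = PGL2_class B <->
  exists2 c : k, c != 0 & (A : 'M_2) = c *: (B : 'M_2).
Proof.
split=> [/eqquotP/asboolP//|h]; apply/eqquotP; exact/asboolP.
Qed.

Lemma PGL2_reprP (A : GL2) :
  exists2 c : k, c != 0 & (repr (PGL2_class A) : 'M_2) = c *: (A : 'M_2).
Proof. by apply/PGL2_classP; rewrite /PGL2_class reprK. Qed.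

Definition PGL2_one : PGL2 := PGL2_class 1%g.
Definition PGL2_mul (g h : PGL2) : PGL2 := PGL2_class (repr g * repr h)%g.
Definition PGL2_inv (g : PGL2) : PGL2 := PGL2_class (repr g)^-1%g.

Lemma PGL2_mulE A B : PGL2_mul (PGL2_class A) (PGL2_class B) = PGL2_class (A * B)%g.
Proof.
apply/PGL2_classP; have [c c0 /= ->] := PGL2_reprP A.
have [d d0 /= ->] := PGL2_reprP B; exists (c * d); first by rewrite mulf_neq0.
by rewrite -scalemxAl -scalemxAr scalerA.
Qed.

Lemma PGL2_invE A : PGL2_inv (PGL2_class A) = PGL2_class A^-1%g.
Proof.
apply/PGL2_classP; have [c c0 /= ->] := PGL2_reprP A.
exists c^-1; first by rewrite invr_eq0.
by rewrite invmxZ // unitmxZ ?unitfE // GL2_unit.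
Qed.

Lemma PGL2_classK (g : PGL2) : PGL2_class (repr g) = g.
Proof. exact: reprK. Qed.

Fact PGL2_mulA : associative PGL2_mul.
Proof.
move=> g h l; rewrite -[g]PGL2_classK -[h]PGL2_classK -[l]PGL2_classK.
by rewrite !PGL2_mulE mulgA.
Qed.
Fact PGL2_mul1 : left_id PGL2_one PGL2_mul.
Proof. by move=> g; rewrite -[g]PGL2_classK PGL2_mulE mul1g. Qed.
Fact PGL2_mulr1 : right_id PGL2_one PGL2_mul.
Proof. by move=> g; rewrite -[g]PGL2_classK PGL2_mulE mulg1. Qed.
Fact PGL2_mulV : left_inverse PGL2_one PGL2_inv PGL2_mul.
Proof. by move=> g; rewrite -[g]PGL2_classK PGL2_invE PGL2_mulE mulVg. Qed.
Fact PGL2_mulrV : right_inverse PGL2_one PGL2_inv PGL2_mul.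
Proof. by move=> g; rewrite -[g]PGL2_classK PGL2_invE PGL2_mulE mulgV. Qed.
HB.instance Definition _ :=
  isGroup.Build PGL2 PGL2_mulA PGL2_mul1 PGL2_mulr1 PGL2_mulV PGL2_mulrV.

Definition ratx : {fraction {poly k}} := 'X%:F.
Definition ratC (c : k) : {fraction {poly k}} := c%:P%:F.

Definition moebius_mx (A : 'M[k]_2) : {fraction {poly k}} :=
  (ratC (A 0 0) * ratx + ratC (A 0 1)) / (ratC (A 1 0) * ratx + ratC (A 1 1)).

(* The fractional linear transformation g(x), as an element of k(x). *)
Definition moebius (g : PGL2) : {fraction {poly k}} := moebius_mx (repr g : GL2).

Lemma moebiusE (A : GL2) : moebius (PGL2_class A) = moebius_mx A.
Proof.
rewrite /moebius; have [c c0 ->] := PGL2_reprP A; rewrite /moebius_mx !mxE.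
rewrite /ratC !polyCM !rmorphM /= -!mulrA -!mulrDr invfM mulrACA mulfV ?mul1r //.
by rewrite tofrac_eq0 polyC_eq0.
Qed.

(* The matrix [1 1; 0 1]. *)
Definition shift_mx : 'M[k]_2 := \matrix_(i, j) (i <= j)%N%:R.
Fact shift_mx_unit : shift_mx \in unitmx.
Proof.
rewrite unitmxE -det_tr det_trig; last first.
  by apply/is_trig_mxP => i j lt_ij; rewrite !mxE leqNgt lt_ij.
by rewrite big1 ?unitr1 // => i _; rewrite !mxE leqnn.
Qed.
Definition shift : PGL2 := PGL2_class (GL2Of shift_mx_unit).

Lemma moebius1 : moebius 1%g = ratx.
Proof.
rewrite moebiusE /moebius_mx !mxE /= /ratC polyC0 polyC1 rmorph0 rmorph1.
by rewrite mul1r mul0r add0r addr0 divr1.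
Qed.

Lemma moebius_shift : moebius shift = 1 + ratx.
Proof.
rewrite moebiusE /moebius_mx !mxE /= /ratC polyC0 polyC1 rmorph0 rmorph1.
by rewrite mul1r mul0r add0r divr1 addrC.
Qed.

Lemma shift_neq1 : shift <> 1%g.
Proof.
move/PGL2_classP=> [c _ /matrixP/(_ 0 1)/eqP].
by rewrite !mxE /= mulr0 oner_eq0.
Qed.

Definition Gamma : set PGL2 := [set 1%g; shift].

End PGL2.
Arguments Gamma : clear implicits.
Arguments shift : clear implicits.

Lemma shift_mulK (k : fieldType) : 2%N \in [pchar k] -> (shift k * shift k = 1)%g.
Proof.
move=> k2; rewrite [LHS]PGL2_mulE; congr PGL2_class; apply: val_inj => /=.
have k20 : 1 + 1 = 0 :> k by rewrite -(pcharf0 k2).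
apply/matrixP => -[[|[|//]] ?] -[[|[|//]] ?];
  by rewrite !mxE !big_ord_recl big_ord0 !mxE /= ?(mulr0, mulr1, addr0, add0r).
Qed.

Section ParameterSet.
Context {k : fieldType} (k2 : 2%N \in [pchar k]).

Record calN := CalN {
  Na : k;
  Nb : k;
  Nc : k;
  Nd : kAS k2;
  Na_neq0 : Na != 0;
  Nbc_neq0 : (Nb, Nc) != (0, 0)
}.

Lemma calN_eq (n m : calN) :
  Na n = Na m -> Nb n = Nb m -> Nc n = Nc m -> Nd n = Nd m -> n = m.
Proof.
case: n m => [a b c d a0 bc0] [a' b' c' d' a0' bc0'] /= ea eb ec ed.
case: _ / ea a0' => a0'; case: _ / eb bc0' => bc0'; case: _ / ec bc0' => bc0'.
by case: _ / ed; rewrite (bool_irrelevance a0 a0') (bool_irrelevance bc0 bc0').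
Qed.

Fact act_shift_neq0 (n : calN) : (Nb n, Nb n + Nc n) != (0, 0).
Proof.
case: n => a b c d _ /=; apply: contra => /eqP[-> /eqP].
by rewrite add0r => /eqP ->.
Qed.

(* The action n^g; only its restriction to g in Gamma is meaningful. *)
Definition Nact (n : calN) (g : PGL2 k) : calN :=
  if g == 1%g then n
  else @CalN (Na n) (Nb n) (Nb n + Nc n) (Nd n + AS_class k2 (Na n))
             (Na_neq0 n) (act_shift_neq0 n).

Lemma Nact1 n : Nact n 1%g = n.
Proof. by rewrite /Nact eqxx. Qed.

Lemma Nact_mul n g h : Gamma k g -> Gamma k h -> Nact (Nact n g) h = Nact n (g * h)%g.
Proof.
have s1 : (shift k == 1%g) = false by apply/eqP/shift_neq1.
move=> [->|->] [->|->]; rewrite ?mul1g ?mulg1 ?Nact1 //.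
rewrite shift_mulK // Nact1 /Nact s1; apply: calN_eq => //=.
  by rewrite addrA (addrr_pchar2 k2) add0r.
by rewrite -addrA -AS_classD (addrr_pchar2 k2) [AS_class _ 0]raddf0 addr0.
Qed.

Definition isotropy (n : calN) : set (PGL2 k) :=
  [set g | Gamma k g /\ Nact n g = n].

End ParameterSet.

Record function_field (k : fieldType) := FunctionField {
  ff_sort :> fieldType;
  ff_const : {rmorphism k -> ff_sort}
}.
Arguments ff_const {k} K : rename.

(* The smooth projective curve with function field K is realized by its local
   rings: its points are the valuation rings of K over k (the closed points are
   the places of K/k, the generic point is K itself), the topology is the
   Zariski topology, generated by the loci of regularity {P | f \in O_P} of the
   elements of K, and a rational function is regular on an open set when it lies
   in the local rings of all its points. *)
Section Curve.
Context {k : fieldType} (K : function_field k).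

Definition valuation_ring (O : set K) : Prop :=
  [/\ forall c : k, O (ff_const K c),
      forall f g : K, O f -> O g -> O (f - g),
      forall f g : K, O f -> O g -> O (f * g) &
      forall f : K, ~ O f -> O f^-1].

Record curve := CurvePoint {
  local_ring : set K;
  local_ringP : valuation_ring local_ring
}.

Definition regular_locus (f : K) : set curve := [set P | local_ring P f].

HB.instance Definition _ := gen_eqMixin curve.
HB.instance Definition _ := gen_choiceMixin curve.
HB.instance Definition _ :=
  isSubBaseTopological.Build curve (range regular_locus) id.

Definition regular_on (U : set curve) (f : K) : Prop :=
  forall P, U P -> local_ring P f.

End Curve.

(* Dominant k-morphisms, as in the elementary theory of varieties: a continuous
   map on points together with the induced embedding of function fields (in the
   opposite direction), pulling back regular functions to regular functions. *)
Record curve_hom (k : fieldType) (K L : function_field k) := CurveHom {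
  on_points :> curve K -> curve L;
  pullback : L -> K;
  on_points_continuous : continuous on_points;
  pullback_sub : zmod_morphism pullback;
  pullback_mul : monoid_morphism pullback;
  pullback_const : forall c, pullback (ff_const L c) = ff_const K c;
  pullback_regular : forall U, open U -> forall f, regular_on U f ->
    regular_on (on_points @^-1` U) (pullback f)
}.

Section CurveHom.
Context {k : fieldType}.
Implicit Types K L M : function_field k.

Lemma curve_hom_eq K L (phi psi : curve_hom K L) :
  on_points phi = on_points psi -> pullback phi = pullback psi -> phi = psi.
Proof.
case: phi psi => [f u c1 s1 m1 k1 r1] [g v c2 s2 m2 k2 r2] /= efg euv.
case: _ / efg c2 r2 => c2 r2; case: _ / euv s2 m2 k2 r2 => s2 m2 k2 r2.
by congr CurveHom; exact: Prop_irrelevance.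
Qed.

Definition curve_id K : curve_hom K K.
Proof. by exists id id => // x. Defined.

Definition curve_comp K L M (psi : curve_hom L M) (phi : curve_hom K L) :
  curve_hom K M.
Proof.
exists (psi \o phi) (pullback phi \o pullback psi).
- by move=> P; apply: continuous_comp; apply: on_points_continuous.
- by move=> f g /=; rewrite !pullback_sub.
- by split=> [|f g] /=; rewrite ?(pullback_mul _).1 ?(pullback_mul _).2.
- by move=> c /=; rewrite !pullback_const.
- move=> U oU f rf; apply: (@pullback_regular _ _ _ phi (psi @^-1` U)).
    exact: (continuousP _).1 (@on_points_continuous _ _ _ psi) _ oU.
  exact: pullback_regular.
Defined.

Lemma curve_compA K L M N (f : curve_hom M N) (g : curve_hom L M)
    (h : curve_hom K L) :
  curve_comp f (curve_comp g h) = curve_comp (curve_comp f g) h.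
Proof. exact: curve_hom_eq. Qed.

Lemma curve_comp1 K L (f : curve_hom K L) : curve_comp (curve_id L) f = f.
Proof. exact: curve_hom_eq. Qed.

Lemma curve_compr1 K L (f : curve_hom K L) : curve_comp f (curve_id K) = f.
Proof. exact: curve_hom_eq. Qed.

Definition k_isomorphic K L : Prop :=
  exists (phi : curve_hom K L) (psi : curve_hom L K),
    curve_comp psi phi = curve_id K /\ curve_comp phi psi = curve_id L.

End CurveHom.

Section Automorphisms.
Context {k : fieldType} (K : function_field k).

Record curve_aut := CurveAut {
  aut_hom :> curve_hom K K;
  aut_inv_hom : curve_hom K K;
  aut_homK : curve_comp aut_inv_hom aut_hom = curve_id K;
  aut_inv_homK : curve_comp aut_hom aut_inv_hom = curve_id K
}.
HB.instance Definition _ := gen_eqMixin curve_aut.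
HB.instance Definition _ := gen_choiceMixin curve_aut.

Lemma curve_aut_eq (f g : curve_aut) : aut_hom f = aut_hom g -> f = g.
Proof.
case: f g => [f f' h1 h2] [g g' h3 h4] /= efg.
case: _ / efg h3 h4 => h3 h4.
have ef : f' = g' by rewrite -[f']curve_compr1 -h4 curve_compA h1 curve_comp1.
by case: _ / ef h3 h4 => h3 h4; congr CurveAut; exact: Prop_irrelevance.
Qed.

Definition aut_one : curve_aut.
Proof. by exists (curve_id K) (curve_id K); exact: curve_comp1. Defined.

Definition aut_mul (f g : curve_aut) : curve_aut.
Proof.
exists (curve_comp f g) (curve_comp (aut_inv_hom g) (aut_inv_hom f)).
  by rewrite -curve_compA (curve_compA _ f) aut_homK curve_comp1 aut_homK.
by rewrite -curve_compA (curve_compA _ _ (aut_inv_hom f)) aut_inv_homK curve_comp1 aut_inv_homK.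
Defined.

Definition aut_inv (f : curve_aut) : curve_aut :=
  CurveAut (aut_inv_homK f) (aut_homK f).

Fact aut_mulA : associative aut_mul.
Proof. by move=> f g h; apply: curve_aut_eq; exact: curve_compA. Qed.
Fact aut_mul1 : left_id aut_one aut_mul.
Proof. by move=> f; apply: curve_aut_eq; exact: curve_comp1. Qed.
Fact aut_mulr1 : right_id aut_one aut_mul.
Proof. by move=> f; apply: curve_aut_eq; exact: curve_compr1. Qed.
Fact aut_mulV : left_inverse aut_one aut_inv aut_mul.
Proof. by move=> f; apply: curve_aut_eq; exact: aut_homK. Qed.
Fact aut_mulrV : right_inverse aut_one aut_inv aut_mul.
Proof. by move=> f; apply: curve_aut_eq; exact: aut_inv_homK. Qed.
HB.instance Definition _ :=
  isGroup.Build curve_aut aut_mulA aut_mul1 aut_mulr1 aut_mulV aut_mulrV.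

End Automorphisms.

Lemma fractionE (R : idomainType) (u : {fraction R}) :
  exists2 pq : R * R, pq.2 != 0 & u = pq.1%:F / pq.2%:F.
Proof.
elim/quotW: u => u; exists (\n_u, \d_u) => /=; first exact: denom_ratioP.
apply/(canRL (mulfK _)); first by rewrite tofrac_eq0 denom_ratioP.
rewrite [LHS]/GRing.mul /= !piE; apply/eqmodP => /=.
rewrite FracField.equivfE /FracField.mulf !numden_Ratio ?mulf_neq0 ?oner_eq0 ?denom_ratioP //.
by rewrite !mulr1 mulrC.
Qed.

Fact clear_denom (F : fieldType) (A B C D x q : F) : q != 0 ->
  (A * x + D) * q + (B * x + C) = (A * x + (B * x + C) / q + D) * q.
Proof. by move=> q0; field. Qed.

Fact clear_square (F : fieldType) (p s q : F) : s != 0 ->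
  p * (p + s) * q = s ^+ 2 * (((p / s) ^+ 2 + p / s) * q).
Proof. by move=> s0; field. Qed.

Section CurveAbcd.
Context {k : fieldType} (r a b c d : k).

Definition rhs : {fraction {poly k}} :=
  ratC a * ratx k + (ratC b * ratx k + ratC c) / (ratx k ^+ 2 + ratx k + ratC r)
  + ratC d.

Definition eqn : {poly {fraction {poly k}}} := 'X^2 + 'X - rhs%:P.

Lemma size_monic_eqn : (size eqn = 3%N) * (eqn \is monic).
Proof.
have s : (size ('X - rhs%:P)%R < size ('X^2 : {poly {fraction {poly k}}})%R)%N.
  by rewrite size_polyXn size_XsubC.
rewrite /eqn -addrA; split; first by rewrite size_polyDl // size_polyXn.
by rewrite monicE lead_coefDl // lead_coefXn.
Qed.

Lemma rhs_not_AS (u : {fraction {poly k}}) : a != 0 -> u ^+ 2 + u != rhs.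
Proof.
move=> a0; have [[p s] /= s0 ->] := fractionE u; apply/eqP => e.
pose q : {poly k} := 'X^2 + 'X + r%:P.
have sq : size q = 3%N.
  have sX : (size ('X + r%:P : {poly k})%R < size ('X^2 : {poly k})%R)%N.
    by rewrite size_polyXn size_XaddC.
  by rewrite /q -addrA size_polyDl // size_polyXn.
have q0 : q != 0 by rewrite -size_poly_eq0 sq.
pose l : {poly k} := a%:P * 'X + d%:P.
have sl : size l = 2%N.
  by rewrite /l size_polyDl ?size_Cmul ?size_polyX // (leq_ltn_trans (size_polyC_leq1 _)).
pose N : {poly k} := l * q + (b%:P * 'X + c%:P).
have l0 : l != 0 by rewrite -size_poly_eq0 sl.
have slq : size (l * q) = 4%N by rewrite size_mul // sl sq.
have sN : size N = 4%N.
  rewrite /N size_polyDl slq // (leq_ltn_trans (size_polyD _ _)) // gtn_max.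
  rewrite (leq_ltn_trans (size_polyC_leq1 _)) // andbT.
  by rewrite mul_polyC (leq_ltn_trans (size_scale_leq _ _)) // size_polyX.
have N0 : N != 0 by rewrite -size_poly_eq0 sN.
have eN : p * (p + s) * q = s ^+ 2 * N.
  apply/eqP; rewrite -tofrac_eq; apply/eqP.
  have sF : s%:F != 0 by rewrite tofrac_eq0.
  have qF : q%:F != 0 by rewrite tofrac_eq0.
  have eq : q%:F = ratx k ^+ 2 + ratx k + ratC r.
    by rewrite /q !rmorphD /= rmorphXn.
  have eNF : N%:F = rhs * q%:F.
    rewrite /N /l rmorphD rmorphM /= !rmorphD !rmorphM /= -/(ratx k).
    rewrite -/(ratC a) -/(ratC b) -/(ratC c) -/(ratC d).
    by rewrite /rhs -eq; exact: clear_denom.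
  rewrite !tofracM eNF -e tofracD.
  rewrite -[s%:F * s%:F]expr2; move: sF; clear.
  move: (tofrac p) (tofrac s) (tofrac q) => P S Q; exact: clear_square.
have s2N0 : s ^+ 2 * N != 0 by rewrite mulf_neq0 ?expf_neq0.
have pps0 : p * (p + s) * q != 0 by rewrite eN.
move: pps0; rewrite !mulf_eq0 !negb_or => /andP[/andP[p0 ps0] _].
have := congr1 (fun f : {poly k} => size f) eN.
rewrite expr2 !size_mul ?mulf_neq0 // sq sN.
have := size_polyD p s; have : (0 < size s)%N by rewrite size_poly_gt0.
have : (0 < size (p + s)%R)%N by rewrite size_poly_gt0.
have : (0 < size p)%N by rewrite size_poly_gt0.
case: (ltnP (size s) (size p)) => [lt|le].
  by rewrite size_polyDl //; lia.
by move: (size (p + s)%R) => t; lia.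
Qed.

Lemma eqn_irreducible : a != 0 -> monic_irreducible_poly eqn.
Proof.
move=> a0; split; last exact: size_monic_eqn.2.
apply: cubic_irreducible => [|u]; first by rewrite size_monic_eqn.
by rewrite rootE !hornerE subr_eq0 rhs_not_AS.
Qed.

End CurveAbcd.

Section FunctionField.
Context {k : fieldType} (r a b c d : k) (a0 : a != 0).

Definition Kabcd : fieldType := {poly %/ eqn r a b c d with eqn_irreducible r b c d a0}.

Definition of_ratfun (u : {fraction {poly k}}) : Kabcd :=
  qpolyC (eqn r a b c d) u.

Lemma of_ratfun_sub : zmod_morphism of_ratfun.
Proof. exact: raddfB (qpolyC (eqn r a b c d)). Qed.
Lemma of_ratfun_mul : monoid_morphism of_ratfun.
Proof. exact: qpolyC_is_monoid_morphism. Qed.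
HB.instance Definition _ := GRing.isZmodMorphism.Build _ _ of_ratfun of_ratfun_sub.
HB.instance Definition _ := GRing.isMonoidMorphism.Build _ _ of_ratfun of_ratfun_mul.

Definition const_abcd (e : k) : Kabcd := of_ratfun (ratC e).
Lemma const_abcd_sub : zmod_morphism const_abcd.
Proof. by move=> x y; rewrite /const_abcd /ratC !rmorphB. Qed.
Lemma const_abcd_mul : monoid_morphism const_abcd.
Proof. by split=> [|x y]; rewrite /const_abcd /ratC ?rmorph1 ?rmorphM. Qed.
HB.instance Definition _ := GRing.isZmodMorphism.Build _ _ const_abcd const_abcd_sub.
HB.instance Definition _ := GRing.isMonoidMorphism.Build _ _ const_abcd const_abcd_mul.

Definition Cabcd : function_field k :=
  FunctionField (const_abcd : {rmorphism k -> Kabcd}).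

Definition coord_x : Cabcd := of_ratfun (ratx k).
Definition coord_y : Cabcd := in_qpoly (eqn r a b c d) 'X.

Lemma coord_eqn : coord_y ^+ 2 + coord_y = of_ratfun (rhs r a b c d).
Proof.
have eC u : of_ratfun u = in_qpoly (eqn r a b c d) u%:P.
  apply: val_inj; symmetry; apply: in_qpoly_small; rewrite size_polyC.
  by rewrite (leq_ltn_trans _ (size_mk_monic_gt1 _)) //; case: eqP.
have mE : mk_monic (eqn r a b c d) = eqn r a b c d.
  exact: (mk_monicE (eqn_irreducible r b c d a0)).
have e0 : in_qpoly (eqn r a b c d) (eqn r a b c d) = 0.
  apply: val_inj; rewrite /= mE.
  exact: Pdiv.RingMonic.rmodpp (size_monic_eqn r a b c d).2.
apply/eqP; rewrite -subr_eq0 eC /coord_y; apply/eqP; rewrite -[RHS]e0.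
rewrite [X in _ = in_qpoly _ X]/eqn rmorphB; congr (_ - _).
by rewrite rmorphD /= rmorphXn.
Qed.

End FunctionField.

Section Maps.
Context {k : fieldType} {k2 : 2%N \in [pchar k]}.

(* The curve attached to n in N, for a representative e of its fourth
   coordinate. *)
Definition curve_of (r : k) (n : calN k2) (e : k) : function_field k :=
  Cabcd r (Nb n) (Nc n) e (Na_neq0 n).

(* The automorphism phi is (x, y) |-> (g(x), y + v(x)). *)
Definition is_map (r : k) (n : calN k2) (e : k) (phi : curve_aut (curve_of r n e))
    (g : PGL2 k) (v : {fraction {poly k}}) : Prop :=
  pullback phi (coord_x r (Nb n) (Nc n) e (Na_neq0 n)) =
    of_ratfun r (Nb n) (Nc n) e (Na_neq0 n) (moebius g) /\
  pullback phi (coord_y r (Nb n) (Nc n) e (Na_neq0 n)) =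
    coord_y r (Nb n) (Nc n) e (Na_neq0 n) +
    of_ratfun r (Nb n) (Nc n) e (Na_neq0 n) v.

End Maps.

Definition cyclic_subgroup (G : groupType) (g : G) : set G :=
  [set h | exists m : nat, h = (g ^+ m)%g \/ h = (g ^- m)%g].

(* 1 -> N -> G -> H -> 1 is split exact, for subgroups N of G and H of Q, with
   the inclusion on the left and rho on the right. *)
Definition split_exact (G Q : groupType) (N : set G) (rho : G -> Q) (H : set Q) :
    Prop :=
  [/\ {morph rho : x y / (x * y)%g},
      [set g | rho g = 1%g] = N,
      range rho = H &
      exists s : Q -> G,
        (forall p q, H p -> H q -> s (p * q)%g = (s p * s q)%g) /\
        (forall q, H q -> rho (s q) = q)].

(* Only the restriction of f to the subgroup H matters. *)
Definition subgroup_isog (Q G : groupType) (H : set Q) : Prop :=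
  exists f : Q -> G,
    (forall p q, H p -> H q -> f (p * q)%g = (f p * f q)%g) /\
    set_bij H [set: G] f.
Arguments subgroup_isog {Q} G H.

Definition C2 : groupType := 'Z_2.

Lemma Gamma_isog_C2 (k : fieldType) :
  2%N \in [pchar k] -> subgroup_isog C2 (Gamma k).
Proof.
move=> k2; have s1 : (shift k == 1%g) = false by apply/eqP/shift_neq1.
exists (fun g => if g == 1%g then 1%g else (1%R : 'Z_2)); split.
  move=> g h [->|->] [->|->]; rewrite ?mulg1 ?mul1g ?shift_mulK // ?eqxx ?s1.
  - by rewrite mulg1.
  - by rewrite mul1g.
  - by rewrite mulg1.
  - exact/val_inj.
split=> [g _ //|g h|z _].
  by rewrite !inE => -[->|->] [->|->]; rewrite ?eqxx ?s1.
have [->|z1] := eqVneq z 0.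
  by exists 1%g; [left | rewrite eqxx].
exists (shift k); [by right | rewrite s1; apply: val_inj].
by case: z z1 => -[|[|]].
Qed.

(* Main.v *)
(* The point is that a k-isomorphism u of function fields L -> K maps k(x) to k(x); this is
   shown without Riemann-Roch.  If z := u(x_L) were not in k(x_K), then K = k(x_K, z) would be
   quadratic over both k(x_K) and k(z), so by Gauss's lemma z would be a root of a primitive
   P_0 Y^2 + P_1 Y + P_2 with all deg P_i <= 2.  The Artin-Schreier parameter of K / k(x_K) would
   then be P_0 P_2 / P_1^2 modulo AS(k(x_K)), whereas it must have a pole at x^2 + x + r, forcing
   P_1 to be a multiple of that polynomial, and a pole at infinity, forcing deg P_0 P_2 > 4.
   The same degree argument shows that u(x_L) is a fractional linear transformation of x_K.
   Then u(y_L) = y_K + v, and comparing the simple poles of the right-hand sides modulo v^2 + v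
   forces the transformation to fix infinity and the roots of x^2 + x + r, i.e. to be x or x + 1,
   and v to be constant.
   For morphisms of curves, the map on points is determined by the pullback: the local ring of
   the image of P is the preimage of the local ring of P. *)
From HB Require Import structures.
Require Import Defs.
From mathcomp Require Import all_boot all_order all_algebra.
From mathcomp Require Import qfpoly polyXY fraction.
From mathcomp Require Import boolp classical_sets filter topology_structure.
From mathcomp Require Import ring zify.

Set Implicit Arguments.
Unset Strict Implicit.
Unset Printing Implicit Defensive.

Import GRing.Theory.
Local Open Scope ring_scope.

(** * Gauss's lemma for polynomials over k[x] *)

Lemma size2_polyE (R : nzRingType) (p : {poly R}) :
  (size p <= 2)%N -> p = (p`_0)%:P + (p`_1)%:P * 'X.
Proof.
move=> sp; apply/polyP => -[|[|i]].
- by rewrite coefD coefC coefMX addr0.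
- by rewrite coefD coefC coefMX coefC add0r.
- by rewrite coefD coefC coefMX coefC addr0 nth_default // (leq_trans sp).
Qed.

Lemma size_linear (R : nzRingType) (a b : R) : (size (a *: 'X + b%:P)%R <= 2)%N.
Proof.
rewrite (leq_trans (size_polyD _ _)) // geq_max (leq_trans (size_scale_leq _ _)) ?size_polyX //.
by rewrite (leq_trans (size_polyC_leq1 _)).
Qed.

(** Supplies the monic irreducible [h] whose residue field k[x]/h is needed in Gauss's lemma. *)
Lemma monic_irreducible_factor (k : fieldType) (p : {poly k}) :
  (1 < size p)%N -> exists2 q, monic_irreducible_poly q & q %| p.
Proof.
have [n] := ubnP (size p); elim: n p => // n IHn p; rewrite ltnS => le_pn p_gt1.
have p0 : p != 0 by rewrite -size_poly_gt0; lia.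
have [p_irr|p_red] := pselect (irreducible_poly p).
  have lp0 : (lead_coef p)^-1 != 0 by rewrite invr_eq0 lead_coef_eq0.
  exists ((lead_coef p)^-1 *: p); last by rewrite dvdpZl.
  split; last by rewrite monicE lead_coefZ mulVf // lead_coef_eq0.
  split=> [|q q1]; first by rewrite size_scale.
  by rewrite dvdpZr // => /(p_irr.2 _ q1)/eqp_trans; apply; rewrite eqp_sym eqp_scale.
have [q [q1 qp nqp]] : exists q : {poly k}, [/\ size q != 1%N, q %| p & ~~ (q %= p)].
  apply: contrapT => nq; apply: p_red; split=> // q q1 qp.
  by apply: contrapT => /negP nqp; apply: nq; exists q.
have q0 : q != 0 by apply: contraNneq p0 => q0; rewrite -dvd0p -q0.
have lt_qp : (size q < size p)%N.
  by rewrite ltn_neqAle dvdp_leq // andbT; apply: contra nqp; rewrite dvdp_size_eqp.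
have q_gt1 : (1 < size q)%N by rewrite ltn_neqAle eq_sym q1 size_poly_gt0.
have [s s_irr sq] := IHn q (leq_trans lt_qp le_pn) q_gt1.
by exists s => //; apply: dvdp_trans qp.
Qed.

Lemma in_qpoly_eq0 (k : fieldType) (h p : {poly k}) :
  monic_irreducible_poly h -> (in_qpoly h p == 0) = (h %| p).
Proof.
by move=> hI; rewrite -(inj_eq val_inj) /= (mk_monicE hI) -Pdiv.IdomainMonic.modpE ?hI.2.
Qed.

Lemma dvdp_divide (k : fieldType) (p : {poly k}) (Q : {poly {poly k}}) :
  (forall i, p %| Q`_i) -> exists Q', Q = p *: Q'.
Proof.
move=> pQ; exists (\poly_(i < size Q) (Q`_i %/ p)); apply/polyP => i.
rewrite coefZ coef_poly; case: ltnP => [_|le]; first by rewrite mulrC divpK.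
by rewrite mulr0 nth_default.
Qed.

Definition primitive_coefs (k : fieldType) (F : {poly {poly k}}) :=
  forall p : {poly k}, (forall i, p %| F`_i) -> (size p <= 1)%N.

(** The irreducible factors [h] of [s] are removed one at a time. Modulo [h] the product [Q * F]
    vanishes over the field k[x]/h, while [F] does not because it is primitive; so [h] divides all
    coefficients of [Q] and cancels. *)
Lemma gauss_dvdp (k : fieldType) (F G Q : {poly {poly k}}) (s : {poly k}) :
  primitive_coefs F -> s != 0 -> s *: G = Q * F -> exists H, G = H * F.
Proof.
move=> primF; have [n] := ubnP (size s); elim: n s Q => // n IHn s Q.
rewrite ltnS => le_sn s0 e.
have [/size1_polyC es|/monic_irreducible_factor[h hI hs]] := leqP (size s) 1.
  move: s`_0 es => c es; have c0 : c != 0 by rewrite -polyC_eq0 -es.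
  by exists (c^-1%:P *: Q); rewrite -scalerAl -e es scalerA -polyCM mulVf ?scale1r.
pose f : {rmorphism {poly k} -> {poly %/ h with hI}} := in_qpoly h.
have /eqP : map_poly f Q * map_poly f F = 0.
  rewrite -rmorphM -e /= map_polyZ; suff /eqP -> : f s == 0 by rewrite scale0r.
  by rewrite in_qpoly_eq0.
have map0 (P : {poly {poly k}}) : map_poly f P = 0 -> forall i, h %| P`_i.
  move=> P0 i; have /eqP : (map_poly f P)`_i = 0 by rewrite P0 coef0.
  by rewrite coef_map in_qpoly_eq0.
have h0 : h != 0 by rewrite (irredp_neq0 hI.1).
rewrite mulf_eq0 => /orP[] /eqP/map0 => [/dvdp_divide[Q' eQ]|/primF]; last first.
  by rewrite leqNgt hI.1.1.
move: hs => /dvdpP[s' es]; have s'0 : s' != 0.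
  by apply: contraNneq s0 => s'0; rewrite es s'0 mul0r.
apply: (IHn s' Q') => //.
  apply: leq_trans le_sn; rewrite es size_mul //.
  have: (1 < size h)%N := hI.1.1.
  by case: (size h) => [|[|m]] // _; rewrite !addnS ltnS leq_addr.
have hP0 : h%:P != 0 by rewrite polyC_eq0.
apply: (mulfI hP0); rewrite !mul_polyC scalerA mulrC -es e eQ.
by rewrite scalerAl.
Qed.

(** Taking out a nonconstant common divisor of the coefficients lowers the degree of the leading
    coefficient, so the process stops. *)
Lemma primitive_part (k : fieldType) (F : {poly {poly k}}) :
  F != 0 -> exists p F', [/\ p != 0, F = p *: F' & primitive_coefs F'].
Proof.
have [n] := ubnP (size (lead_coef F)); elim: n F => // n IHn F; rewrite ltnS => le_n F0.
have [primF|nprim] := pselect (primitive_coefs F).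
  by exists 1, F; rewrite oner_eq0 scale1r.
have [p pF p_gt1] : exists2 p : {poly k}, (forall i, p %| F`_i) & (1 < size p)%N.
  apply: contrapT => np; apply: nprim => p pF; rewrite leqNgt; apply/negP => p_gt1.
  by apply: np; exists p.
have [F1 eF] := dvdp_divide pF.
have F10 : F1 != 0 by apply: contraNneq F0 => F10; rewrite eF F10 scaler0.
have p0 : p != 0 by rewrite -size_poly_gt0 (ltn_trans _ p_gt1).
have lF1 : lead_coef F1 != 0 by rewrite lead_coef_eq0.
have [|q [F' [q0 eF1 primF']]] := IHn F1 _ F10; last first.
  by exists (p * q), F'; rewrite mulf_neq0 // -scalerA -eF1.
apply: leq_trans le_n; rewrite eF -mul_polyC lead_coefM lead_coefC size_mul //.
move: lF1; rewrite -size_poly_gt0.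
case: (size p) p_gt1 => [|[|m]] // _.
by case: (size _) => // l _; rewrite !addSn /= ltnS leq_addl.
Qed.

(* [F] divides [G] over k(x), hence over k[x] by Gauss's lemma; [sizeY] measures the degree in x,
   the variable of the coefficients. *)
Lemma primitive_relation_sizeY (k : fieldType) (E : fieldType)
    (ev : {rmorphism {poly k} -> E}) (z : E) (F G : {poly {poly k}}) :
  primitive_coefs F -> F != 0 -> root (map_poly ev F) z ->
  (forall R : {poly {poly k}}, (size R < size F)%N -> root (map_poly ev R) z -> R = 0) ->
  G != 0 -> root (map_poly ev G) z -> (sizeY F <= sizeY G)%N.
Proof.
move=> primF F0 Fz minF G0 Gz.
have [H eG] : exists H, G = H * F.
  (* Pseudo-division over k[x]: a power of the leading coefficient of [F] times [G] is a multiple of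
     [F] plus a remainder, which also vanishes at [z] and so is zero by minimality. *)
  have e := Pdiv.Idomain.divp_eq G F.
  have m0 : G %% F = 0.
    apply: minF; first by rewrite ltn_modp.
    have -> : G %% F = lead_coef F ^+ scalp G F *: G - G %/ F * F by rewrite e addrAC subrr add0r.
    rewrite /root rmorphB rmorphM /= map_polyZ !hornerE (rootP Gz) (rootP Fz).
    by rewrite !mulr0 subrr.
  apply: (@gauss_dvdp _ F G (G %/ F) (lead_coef F ^+ scalp G F)) => //.
    by rewrite expf_neq0 // lead_coef_eq0.
  by rewrite e m0 addr0.
have H0 : H != 0 by apply: contraNneq G0 => H0; rewrite eG H0 mul0r.
rewrite !sizeYE eG rmorphM /= size_mul ?swapXY_eq0 //.
move: H0; rewrite -swapXY_eq0 -size_poly_gt0.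
by case: (size (swapXY H)) => // n _; rewrite addSn leq_addl.
Qed.

(** * Poles at x^2 + x + r and at infinity *)

Section Poles.
Context {k : fieldType} (k2 : 2%N \in [pchar k]) (r : k) (r_notin_AS : ~~ AS k2 r).

Definition quad : {poly k} := 'X^2 + 'X + r%:P.

Lemma size_quad : size quad = 3%N.
Proof.
have sX : (size ('X + r%:P : {poly k})%R < size ('X^2 : {poly k})%R)%N.
  by rewrite size_polyXn size_XaddC.
by rewrite /quad -addrA size_polyDl // size_polyXn.
Qed.

Lemma quad_neq0 : quad != 0.
Proof. by rewrite -size_poly_eq0 size_quad. Qed.

(** In degree 2 it suffices to exclude roots, and a root would exhibit [r] as an element of
    AS(k). *)
Lemma quad_irreducible : irreducible_poly quad.
Proof.
apply: cubic_irreducible => [|x]; first by rewrite size_quad.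
apply: contra r_notin_AS; rewrite rootE !hornerE addr_eq0 (oppr_pchar2 k2) => /eqP e.
by apply/ASP; exists x; rewrite addrC.
Qed.

Lemma quad_prime (p q : {poly k}) : quad %| p * q -> (quad %| p) || (quad %| q).
Proof.
move=> h; case: (boolP (quad %| p)) => //=.
by rewrite -irreducible_poly_coprime; [move/Gauss_dvdpr <- | exact: quad_irreducible].
Qed.

(** Numerator of [rhs r a b c d] over the denominator [quad], as [rhs_quad] confirms. *)
Definition rhs_num (a b c d : k) : {poly k} :=
  (a *: 'X + d%:P) * quad + (b *: 'X + c%:P).

(** Modulo [quad] only b x + c remains, nonzero of degree at most 1; so the right-hand side really
    has a pole at [quad]. *)
Lemma quad_ndvd_rhs_num a b c d : (b, c) != (0, 0) -> ~~ (quad %| rhs_num a b c d).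
Proof.
move=> bc0; rewrite (dvdp_addr _ (dvdp_mull _ (dvdpp quad))).
have l0 : b *: 'X + c%:P != 0.
  apply: contra bc0 => /eqP/polyP e.
  have := e 1%N; have := e 0%N; rewrite !coefE !(mulr0, mulr1, add0r, addr0).
  by move=> -> ->.
by apply/negP => /(dvdp_leq l0); rewrite size_quad leqNgt ltnS size_linear.
Qed.

Lemma size_rhs_num a b c d : a != 0 -> size (rhs_num a b c d) = 4%N.
Proof.
move=> a0; have sl : size (a *: 'X + d%:P) = 2%N.
  by rewrite size_polyDl size_scale ?size_polyX // (leq_ltn_trans (size_polyC_leq1 _)).
have slq : size ((a *: 'X + d%:P) * quad) = 4%N.
  by rewrite size_mul ?quad_neq0 // -?size_poly_eq0 sl ?size_quad.
by rewrite /rhs_num size_polyDl slq // (leq_ltn_trans (size_linear _ _)).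
Qed.

Lemma rhs_numE a b c d : rhs_num a b c d =
  a *: 'X^3 + (a + d) *: 'X^2 + (a * r + d + b) *: 'X + (d * r + c)%:P.
Proof. by rewrite /rhs_num /quad -!mul_polyC !(polyCD, polyCM); ring. Qed.

(* The equation says that M / D = rhs + v^2 + v with v = p / s; poles of v^2 + v have even
   order, so the simple poles of rhs at [quad] and at infinity survive in M / D. *)
Lemma AS_equivalent_poles a b c d (M D p s : {poly k}) :
  a != 0 -> (b, c) != (0, 0) -> D != 0 -> s != 0 -> coprimep p s ->
  M * s ^+ 2 * quad = D * (rhs_num a b c d * s ^+ 2 + p * (p + s) * quad) ->
  quad %| D /\ (size D < size M)%N.
Proof.
move=> a0 bc0 D0 s0 cps e; split.
  apply: contraT => nqD.
  (* If [quad] does not divide [D] it divides [s]; after cancelling one factor [quad] it also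
     divides [p * (p + s)], hence [p], against coprimality. *)
  have : quad %| s.
    have : quad %| D * (rhs_num a b c d * s ^+ 2 + p * (p + s) * quad).
      by rewrite -e dvdp_mull.
    move/quad_prime; rewrite (negPf nqD) /= (dvdp_addl _ (dvdp_mull _ (dvdpp quad))).
    move/quad_prime; rewrite (negPf (quad_ndvd_rhs_num _ _ bc0)) /=.
    by rewrite expr2 => /quad_prime; rewrite orbb.
  move=> /dvdpP[s1 es].
  have e1 : M * s1 ^+ 2 * quad ^+ 2 =
      D * (rhs_num a b c d * s1 ^+ 2 * quad + p * (p + s)).
    by apply: (mulfI quad_neq0); move: e; rewrite es => e; ring: e.
  have : quad %| D * (rhs_num a b c d * s1 ^+ 2 * quad + p * (p + s)).
    by rewrite -e1 dvdp_mull // expr2 dvdp_mull.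
  move/quad_prime; rewrite (negPf nqD) /= (dvdp_addr _ (dvdp_mull _ (dvdpp quad))) => /quad_prime qp.
  have qs : quad %| s by rewrite es dvdp_mull.
  have {}qp : quad %| p by case/orP: qp => //; rewrite dvdp_addl.
  have : quad %| gcdp p s by rewrite dvdp_gcd qp.
  move: cps; rewrite -gcdp_eqp1 => /eqp_dvdr ->.
  by rewrite dvdp1 size_quad.
set T := (X in D * X) in e.
have s_gt0 : (0 < size s)%N by rewrite size_poly_gt0.
have szN : size (rhs_num a b c d * s ^+ 2) = ((size s).*2 + 2)%N.
  have N0 : rhs_num a b c d != 0 by rewrite -size_poly_eq0 size_rhs_num.
  rewrite expr2 !size_mul ?mulf_neq0 // size_rhs_num //.
  by move: (size s) s_gt0 => n; lia.
(* The leading terms of the two summands of [T] cannot cancel: the first has odd degree 2 deg s + 3,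
   the second has degree at most 2 deg s + 2 if deg p <= deg s and even degree 2 deg p + 2
   otherwise. *)
have sT : ((size s).*2 + 2 <= size T)%N.
  have [le|lt] := leqP (size p) (size s).
    rewrite /T size_polyDl szN //.
    apply: (leq_ltn_trans (size_polyMleq _ _)); rewrite size_quad.
    have := size_polyMleq p (p + s); have := size_polyD p s.
    move: (size (p * _)) (size (p + s)%R) (size p) (size s) s_gt0 le => x y z t.
    by rewrite /maxn; case: ifP; lia.
  have p0 : p != 0 by rewrite -size_poly_gt0 (leq_ltn_trans _ lt).
  have sps : size (p + s) = size p by rewrite size_polyDl.
  have ps0 : p + s != 0 by rewrite -size_poly_gt0 sps (leq_ltn_trans _ lt).
  have sp : size (p * (p + s) * quad) = ((size p).*2 + 1)%N.
    rewrite !size_mul ?mulf_neq0 ?quad_neq0 // sps size_quad.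
    by move: (size p) (leq_ltn_trans (leq0n _) lt) => n; lia.
  rewrite /T addrC size_polyDl sp ?szN.
    by move: lt; lia.
  by move: lt; lia.
have T0 : T != 0 by rewrite -size_poly_gt0; move: sT; lia.
have M0 : M != 0.
  apply: contraTneq (mulf_neq0 D0 T0) => M0.
  by rewrite -e M0 !mul0r eqxx.
have := congr1 (fun f : {poly k} => size f) e.
rewrite expr2 !size_mul ?mulf_neq0 ?quad_neq0 // size_quad.
move: M0 D0; rewrite -!size_poly_gt0.
move: (size M) (size D) (size T) (size s) s_gt0 sT; clear.
by move=> x y z t; lia.
Qed.

(* The hypothesis says that a x + d + (b x + c) / quad = v^2 + v with v = p / s. *)
Lemma AS_rhs_trivial a b c d (p s : {poly k}) :
  s != 0 -> coprimep p s -> p * (p + s) * quad = s ^+ 2 * rhs_num a b c d ->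
  exists e : k, [/\ a = 0, b = 0, c = 0, d = e + e ^+ 2 & p = e *: s].
Proof.
move=> s0 cps; rewrite mulrC => e.
have cs : coprimep (s ^+ 2) (p * (p + s)).
  rewrite coprimep_expl // coprimepMr coprimep_sym cps /=.
  by rewrite addrC -[X in X + p]mul1r coprimep_addl_mul coprimep_sym.
have sq : s ^+ 2 %| quad by rewrite -(Gauss_dvdpl _ cs) e dvdp_mulr.
(* The irreducible [quad] has no nonconstant square factor. *)
have s1 : size s = 1%N.
  apply/eqP; apply: contraT => s1.
  have /(quad_irreducible.2 _ s1)/eqp_size es : s %| quad.
    by apply: dvdp_trans sq; rewrite expr2 dvdp_mulr.
  have := dvdp_leq quad_neq0 sq.
  by rewrite expr2 size_mul // es size_quad.
have /size_poly1P[t t0 et] : size s == 1%N by rewrite s1.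
have [p1 ep] : exists p1, p = t *: p1.
  by exists (t^-1 *: p); rewrite scalerA mulfV ?scale1r.
have e1 : quad * (p1 * (p1 + 1)) = rhs_num a b c d.
  have tP0 : t%:P ^+ 2 != 0 by rewrite expf_neq0 // polyC_eq0.
  apply: (mulfI tP0); rewrite -et -e ep et -mul_polyC; ring.
(* Otherwise the left-hand side of [e1] would have degree at least 4, while [rhs_num] has degree at
   most 3. *)
have sp1 : (size p1 <= 1)%N.
  rewrite leqNgt; apply/negP => lt.
  have sp : size (p1 + 1) = size p1 by rewrite size_polyDl // size_poly1.
  have p10 : p1 != 0 by rewrite -size_poly_gt0 (ltn_trans _ lt).
  have p11 : p1 + 1 != 0 by rewrite -size_poly_gt0 sp (ltn_trans _ lt).
  have := congr1 (fun f : {poly k} => size f) e1.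
  rewrite !size_mul ?mulf_neq0 ?quad_neq0 // sp size_quad.
  have : (size (rhs_num a b c d) <= 4)%N.
    rewrite (leq_trans (size_polyD _ _)) // geq_max.
    rewrite (leq_trans (size_linear _ _)) // andbT (leq_trans (size_polyMleq _ _)) // size_quad.
    by have := size_linear a d; case: (size _) => [|[|[|m]]].
  by move: (size (rhs_num _ _ _ _)) (size p1) lt => x y; lia.
move: (size1_polyC sp1); move: (p1`_0) => z ez; exists z.
have e2 : quad * (z * (z + 1))%:P = rhs_num a b c d by rewrite -e1 ez -polyCD -polyCM.
move: e2; rewrite rhs_numE /quad => /polyP e2.
move: (e2 0%N) (e2 1%N) (e2 2%N) (e2 3%N) => {e1 e2}; rewrite !coefE /=.
rewrite !(mulr0, mulr1, add0r, addr0, mul0r, mul1r).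
move=> h0 h1 h2 h3; have a0 : a = 0 by rewrite h3.
move: h0 h1 h2; rewrite a0 mul0r !add0r => h0 h1 h2.
have ed : d = z + z ^+ 2 by rewrite -h2; ring.
split=> //.
- by apply: (addrI d); rewrite addr0 -h1.
- by apply: (addrI (d * r)); rewrite addr0 -h0 h2 mulrC.
- by rewrite ep ez et -!mul_polyC mulrC.
Qed.

(* The two polynomials compared are the denominator and the numerator of
   a m / t + (b m + c t) t / (m^2 + m t + r t^2) + d, which is the right-hand side of the
   equation of the curve at m / t. *)
Lemma pole_preserving a b c d (m t : {poly k}) (qf := m ^+ 2 + m * t + r *: t ^+ 2) :
  (size m <= 2)%N -> (size t <= 2)%N -> t != 0 -> qf != 0 ->
  quad %| t * qf ->
  (size (t * qf)%R < size (a *: m * qf + (b *: m + c *: t) * t ^+ 2 + d *: t * qf)%R)%N ->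
  exists beta : k, (beta == 0) || (beta == 1) /\ m = ('X + beta%:P) * t.
Proof.
move=> sm st t0 q0 qt lt.
have sZ (e : k) (p : {poly k}) : (size p <= 2 -> size (e *: p)%R <= 2)%N.
  by apply: leq_trans; exact: size_scale_leq.
have sD n (u v : {poly k}) : (size u <= n -> size v <= n -> size (u + v)%R <= n)%N.
  by move=> hu hv; rewrite (leq_trans (size_polyD _ _)) // geq_max hu.
have sM n l (u v : {poly k}) : (size u <= n.+1 -> size v <= l.+1 -> size (u * v)%R <= (n + l).+1)%N.
  by move=> hu hv; rewrite (leq_trans (size_polyMleq _ _)) //; lia.
have st2 : (size (t ^+ 2)%R <= 3)%N by rewrite expr2 (sM 1 1)%N.
have sqf : (size qf <= 3)%N.
  rewrite /qf !sD ?(sM 1 1)%N ?expr2 ?(sM 1 1)%N //.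
  by rewrite (leq_trans (size_scale_leq _ _)) // -expr2.
(* The numerator has degree at most 3, so [t * qf] has degree at most 2. As [quad] cannot divide
   [t], it divides [qf], which uses up all of this degree and leaves [t] constant. *)
have : (size (t * qf)%R < 4)%N.
  apply: (leq_trans lt).
  by apply: (sD 4%N); [apply: (sD 4%N)|]; apply: (sM 1 2)%N => //; rewrite ?sD ?sZ.
have nqt : ~~ (quad %| t).
  by apply/negP => /(dvdp_leq t0); rewrite size_quad leqNgt ltnS st.
move/quad_prime: qt; rewrite (negPf nqt) /= => qq.
have sq3 : size qf = 3%N.
  by apply/eqP; rewrite eqn_leq sqf; have := dvdp_leq q0 qq; rewrite size_quad.
rewrite size_mul // sq3 => {}lt.
have /size_poly1P[e e0 et] : size t == 1%N.
  by move: t0 lt; rewrite -size_poly_gt0; move: (size t) => n; lia.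
have [l l0 el] : exists2 l : k, l != 0 & qf = l *: quad.
  have /eqpP[[u v] /= /andP[u0 v0] e1] : quad %= qf by rewrite -dvdp_size_eqp // size_quad sq3.
  exists (v^-1 * u); first by rewrite mulf_neq0 ?invr_eq0.
  by rewrite -scalerA e1 scalerA mulVf ?scale1r.
have em : m = m`_1 *: 'X + (m`_0)%:P by rewrite -mul_polyC addrC -size2_polyE.
move: el; rewrite /qf et em /quad.
move: (m`_1) (m`_0) em => x y em.
have -> : (x *: 'X + y%:P) ^+ 2 + (x *: 'X + y%:P) * e%:P + r *: e%:P ^+ 2
  = (x ^+ 2) *: 'X^2 + (x * e) *: 'X + (y ^+ 2 + y * e + r * e ^+ 2)%:P + (x * y + x * y) *: 'X.
  by rewrite -!mul_polyC !(polyCD, polyCM); ring.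
rewrite (addrr_pchar2 k2) scale0r addr0 => /polyP el.
(* The coefficients give y^2 + y e + r e^2 = l r and x e = l = x^2; hence x = e, and then y (y + e)
   = 0. *)
move: (el 0%N) (el 1%N) (el 2%N) => {el}; rewrite !coefE /=.
rewrite !(mulr0, mulr1, add0r, addr0, mul0r, mul1r) => h0 h1 h2.
have x0 : x != 0 by apply: contraNneq l0 => x0; rewrite -h2 x0 expr0n.
have ex : x = e by apply: (mulfI x0); rewrite h1 -h2 expr2.
exists (y / e); split; last first.
  rewrite ex -!mul_polyC mulrDl -polyCM mulfVK //; ring.
have : (y / e) * (y / e + 1) == 0.
  have -> : (y / e) * (y / e + 1) = (y ^+ 2 + y * e) / e ^+ 2 by field.
  have -> : y ^+ 2 + y * e = 0; last by rewrite mul0r.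
  by apply: (addIr (r * e ^+ 2)); rewrite h0 add0r -h2 ex mulrC.
rewrite mulf_eq0 => /orP[->//|]; rewrite addr_eq0 (oppr_pchar2 k2) => ->.
by rewrite orbT.
Qed.

End Poles.

(** * Rational functions, and the function field as a quadratic extension of k(x) *)

Lemma fraction_coprimeE (k : fieldType) (u : {fraction {poly k}}) :
  exists p s : {poly k}, [/\ s != 0, coprimep p s & u = p%:F / s%:F].
Proof.
have [[p s] /= s0 ->] := fractionE u.
have g0 : gcdp p s != 0 by rewrite gcdp_eq0 negb_and s0 orbT.
have ep := divpK (dvdp_gcdl p s); have es := divpK (dvdp_gcdr p s).
exists (p %/ gcdp p s), (s %/ gcdp p s); split.
- by rewrite divpN0 // dvdp_leq // dvdp_gcdr.
- by rewrite coprimep_div_gcd // s0 orbT.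
transitivity ((p %/ gcdp p s * gcdp p s)%:F / (s %/ gcdp p s * gcdp p s)%:F).
  by rewrite ep es.
rewrite !tofracM invfM mulrACA mulfV ?mulr1 //.
by rewrite tofrac_eq0.
Qed.

(** Universal property of the fraction field: injectivity keeps denominators nonzero, so [f p / f s]
    depends only on the fraction. *)
Lemma fraction_lift (R : idomainType) (F : fieldType) (f : {rmorphism R -> F}) :
  injective f ->
  exists g : {rmorphism {fraction R} -> F}, forall p, g p%:F = f p.
Proof.
move=> f_inj; have f0 p : (f p == 0) = (p == 0) by rewrite -(rmorph0 f) (inj_eq f_inj).
have /choice[g gE] : forall u : {fraction R}, exists y : F,
    forall p s, s != 0 -> u = p%:F / s%:F -> y = f p / f s.
  move=> u; have [[p s] /= s0 eu] := fractionE u.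
  exists (f p / f s) => p' s' s'0; rewrite eu => /eqP.
  rewrite eqr_div ?tofrac_eq0 // -!tofracM tofrac_eq => /eqP e.
  by apply/eqP; rewrite eqr_div ?f0 // -!rmorphM e.
have gP p : g p%:F = f p.
  by rewrite (gE _ p 1) ?oner_eq0 ?tofrac1 ?rmorph1 ?divr1.
have gB : zmod_morphism g.
  move=> u v; have [[p s] /= s0 eu] := fractionE u.
  have [[p' s'] /= s'0 ev] := fractionE v.
  rewrite (gE u p s) // (gE v p' s') // (gE (u - v) (p * s' - p' * s) (s * s')) ?mulf_neq0 //.
    by rewrite rmorphB !rmorphM -!mulNr addf_div ?f0.
  by rewrite eu ev tofracB !tofracM -!mulNr addf_div ?tofrac_eq0.
have gM : monoid_morphism g.
  split=> [|u v]; first by rewrite -tofrac1 gP rmorph1.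
  have [[p s] /= s0 eu] := fractionE u.
  have [[p' s'] /= s'0 ev] := fractionE v.
  rewrite (gE u p s) // (gE v p' s') // (gE (u * v) (p * p') (s * s')) ?mulf_neq0 //.
    by rewrite !rmorphM mulf_div.
  by rewrite eu ev !tofracM mulf_div.
pose G : {rmorphism {fraction R} -> F} :=
  HB.pack g (GRing.isZmodMorphism.Build _ _ g gB) (GRing.isMonoidMorphism.Build _ _ g gM).
by exists G.
Qed.

Lemma of_poly_ext (k : fieldType) (F : nzRingType) (u v : {rmorphism {poly k} -> F}) :
  (forall e, u e%:P = v e%:P) -> u 'X = v 'X -> u =1 v.
Proof.
move=> uvC uvX; elim/poly_ind => [|p e IHp]; first by rewrite !rmorph0.
by rewrite !rmorphD !rmorphM /= IHp uvX uvC.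
Qed.

Section CoordinateRing.
Context {k : fieldType} (r a b c d : k) (a0 : a != 0).
Local Notation K := (Kabcd r b c d a0).
Local Notation ofr := (of_ratfun r b c d a0).
Local Notation Y := (coord_y r b c d a0).

Lemma mk_monic_eqn : mk_monic (Defs.eqn r a b c d) = Defs.eqn r a b c d.
Proof. exact: (mk_monicE (eqn_irreducible r b c d a0)). Qed.

(** Elements of the quotient are remainders modulo a monic polynomial of degree 2, hence linear in
    y. *)
Lemma Kabcd_coord (z : K) : exists A B, z = ofr A + ofr B * Y.
Proof.
have ofrE u : ofr u = in_qpoly (Defs.eqn r a b c d) u%:P.
  apply: val_inj; symmetry; apply: in_qpoly_small; rewrite size_polyC.
  by rewrite (leq_ltn_trans _ (size_mk_monic_gt1 _)) //; case: eqP.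
pose p : {poly {fraction {poly k}}} := z.
have sz : (size p <= 2)%N.
  rewrite -ltnS; apply: (leq_trans (size_mk_monic z)).
  by rewrite mk_monic_eqn size_monic_eqn.
exists p`_0, p`_1; rewrite !ofrE /coord_y.
have -> : z = in_qpoly (Defs.eqn r a b c d) p.
  by apply: val_inj; symmetry; apply: in_qpoly_small; exact: size_mk_monic.
rewrite -[in RHS]in_qpolyM -[in RHS]in_qpolyD; congr in_qpoly.
exact: size2_polyE sz.
Qed.

Lemma ofr_inj : injective ofr.
Proof. exact: fmorph_inj. Qed.

Lemma Y_notin_ratfun u : Y <> ofr u.
Proof.
move=> e; have := coord_eqn r b c d a0; rewrite e -rmorphXn -rmorphD => /ofr_inj/eqP.
by rewrite (negPf (rhs_not_AS _ _ _ _ _ _)).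
Qed.

Lemma Kabcd_coord_eq0 A B : ofr A + ofr B * Y = 0 :> K -> A = 0 /\ B = 0.
Proof.
move=> e; have [B0|B0] := eqVneq B 0.
  by split=> //; apply: ofr_inj; move: e; rewrite B0 !rmorph0 mul0r addr0.
have oB0 : ofr B != 0 by rewrite fmorph_eq0.
case: (@Y_notin_ratfun (- A / B)); rewrite rmorphM fmorphV rmorphN /=.
by apply: (mulfI oB0); rewrite mulrCA mulfV // mulr1; apply/eqP; rewrite -addr_eq0 addrC e.
Qed.

Lemma Kabcd_coord_inj A B A' B' :
  ofr A + ofr B * Y = ofr A' + ofr B' * Y -> A = A' /\ B = B'.
Proof.
move/eqP; rewrite -subr_eq0 => /eqP e.
have [] := @Kabcd_coord_eq0 (A - A') (B - B').
  by rewrite -e !rmorphB; ring.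
by move=> /eqP + /eqP; rewrite !subr_eq0 => /eqP-> /eqP->.
Qed.

(** Universal property of the quotient: evaluation at [y] kills [eqn], so it is unchanged by
    reduction and therefore multiplicative on remainders. *)
Lemma Kabcd_lift (F : fieldType) (g : {rmorphism {fraction {poly k}} -> F}) (y : F) :
  y ^+ 2 + y = g (rhs r a b c d) ->
  exists u : {rmorphism K -> F}, (forall v, u (ofr v) = g v) /\ u Y = y.
Proof.
move=> ey; pose h := Defs.eqn r a b c d.
pose ev (p : {poly {fraction {poly k}}}) := (map_poly g p).[y].
have evD p q : ev (p + q) = ev p + ev q by rewrite /ev rmorphD hornerD.
have evB p q : ev (p - q) = ev p - ev q by rewrite /ev rmorphB !hornerE.
have evM p q : ev (p * q) = ev p * ev q by rewrite /ev rmorphM hornerM.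
have evh : ev h = 0.
  have hE : h = 'X^2 + 'X - (rhs r a b c d)%:P by [].
  rewrite hE; move: (rhs r a b c d) ey => w ey.
  by rewrite evB evD /ev map_polyXn map_polyX map_polyC hornerXn hornerX hornerC ey subrr.
have evmod p : ev (Pdiv.Ring.rmodp p (mk_monic h)) = ev p.
  rewrite [in RHS](Pdiv.RingMonic.rdivp_eq (monic_mk_monic h) p) evD evM.
  by rewrite {2}/h mk_monic_eqn evh mulr0 add0r.
pose u (z : K) := ev z.
have uB : zmod_morphism u by move=> z t; rewrite /u -evB.
have uC v : u (ofr v) = g v by rewrite /u /ev /= map_polyC hornerC.
have uM : monoid_morphism u.
  split=> [|z t]; first by rewrite -(rmorph1 ofr) uC rmorph1.
  by rewrite /u poly_of_qpolyM evmod evM.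
pose U : {rmorphism K -> F} :=
  HB.pack u (GRing.isZmodMorphism.Build _ _ u uB) (GRing.isMonoidMorphism.Build _ _ u uM).
exists U; split=> //=; rewrite /u /coord_y /= evmod.
by rewrite /ev map_polyX hornerX.
Qed.

End CoordinateRing.

(** * Quadratic relations over k[x] *)

Lemma horner_size3 (R : comNzRingType) (p : {poly R}) x :
  (size p <= 3)%N -> p.[x] = p`_0 + p`_1 * x + p`_2 * x ^+ 2.
Proof.
move=> sp; rewrite (horner_coef_wide _ sp) !big_ord_recl big_ord0.
by rewrite /= expr0 expr1 mulr1 addr0 addrA.
Qed.

Lemma clear_fraction (F : fieldType) (p s t : F) : s != 0 -> p * t = s * t * (p / s).
Proof. by move=> s0; field. Qed.

Lemma pchar2_quadratic (F : comNzRingType) (A B y : F) : 2%N \in [pchar F] ->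
  (A + B * y) ^+ 2 + B * (A + B * y) + (A ^+ 2 + A * B + B ^+ 2 * (y ^+ 2 + y)) = 0.
Proof.
move=> /pcharf0 two0.
have -> : (A + B * y) ^+ 2 + B * (A + B * y) + (A ^+ 2 + A * B + B ^+ 2 * (y ^+ 2 + y)) =
  2%:R * (A ^+ 2 + A * B + A * B * y + B ^+ 2 * y ^+ 2 + B ^+ 2 * y) by ring.
by rewrite two0 mul0r.
Qed.

Lemma scaled_quadratic (R : comNzRingType) (g b n z : R) :
  z ^+ 2 + b * z + n = 0 -> g * n + g * b * z + g * z ^+ 2 = 0.
Proof. by move=> e; rewrite -[RHS](mulr0 g) -e; ring. Qed.

Section Relations.
Context {k : fieldType} (k2 : 2%N \in [pchar k]) (r a b c d : k) (a0 : a != 0).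
Local Notation K := (Kabcd r b c d a0).
Local Notation ofr := (of_ratfun r b c d a0).
Local Notation Y := (coord_y r b c d a0).

Definition of_poly : {rmorphism {poly k} -> K} := ofr \o @FracField.tofrac {poly k}.

Lemma pchar_K : 2%N \in [pchar K].
Proof. by apply: (rmorph_pchar of_poly); exact: (rmorph_pchar polyC k2). Qed.

Lemma pchar_ratfun : 2%N \in [pchar {fraction {poly k}}].
Proof. by apply: (rmorph_pchar (@FracField.tofrac {poly k})); exact: (rmorph_pchar polyC k2). Qed.

(** The norm to k(x) of A + B y, namely its product with the conjugate A + B + B y; the trace is
    B. *)
Definition coord_norm (A B : {fraction {poly k}}) := A ^+ 2 + A * B + B ^+ 2 * rhs r a b c d.

Lemma coord_quadratic A B (z := ofr A + ofr B * Y) :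
  z ^+ 2 + ofr B * z + ofr (coord_norm A B) = 0.
Proof.
have -> : ofr (coord_norm A B) = ofr A ^+ 2 + ofr A * ofr B + ofr B ^+ 2 * (Y ^+ 2 + Y).
  by rewrite coord_eqn -!rmorphXn -!rmorphM -!rmorphD.
exact: pchar2_quadratic pchar_K.
Qed.

Lemma size_map_of_poly (F : {poly {poly k}}) : (size (map_poly of_poly F) <= size F)%N.
Proof. exact: size_poly. Qed.

(** The polynomial Z^2 + B Z + N, with B the trace and N the norm, cleared of denominators and
    divided by its content. The last two equations keep track of trace and norm as ratios of
    coefficients. *)
Lemma coord_relation A B : exists F : {poly {poly k}},
  [/\ size F = 3%N, primitive_coefs F, root (map_poly of_poly F) (ofr A + ofr B * Y),
      (F`_1)%:F = (F`_2)%:F * B & (F`_0)%:F = (F`_2)%:F * coord_norm A B].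
Proof.
have [[p s] /= s0 eB] := fractionE B.
have [[q t] /= t0 eN] := fractionE (coord_norm A B).
pose F1 : {poly {poly k}} := Poly [:: q * s; p * t; s * t].
have st0 : s * t != 0 by rewrite mulf_neq0.
have sF1 : size F1 = 3%N by rewrite (@PolyK _ 0).
have F10 : F1 != 0 by rewrite -size_poly_eq0 sF1.
have [g [F [g0 eF primF]]] := primitive_part F10.
have gP0 : g%:P != 0 by rewrite polyC_eq0.
have sF : size F = 3%N by rewrite -sF1 eF -mul_polyC size_Cmul.
have cF i : F1`_i = g * F`_i by rewrite eF coefZ.
have gF0 : g%:F != 0 by rewrite tofrac_eq0.
have sF0 : s%:F != 0 by rewrite tofrac_eq0.
have tF0 : t%:F != 0 by rewrite tofrac_eq0.
have e1 : (F`_1)%:F = (F`_2)%:F * B.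
  apply: (mulfI gF0); rewrite mulrA -!tofracM -!cF !coef_Poly /= !tofracM eB.
  by move: (p%:F) (s%:F) (t%:F) sF0 => p' s' t'; exact: clear_fraction.
have e0 : (F`_0)%:F = (F`_2)%:F * coord_norm A B.
  apply: (mulfI gF0); rewrite mulrA -!tofracM -!cF !coef_Poly /= !tofracM eN.
  by rewrite [s%:F * t%:F]mulrC; move: (q%:F) (t%:F) (s%:F) tF0 => q' t' s'; exact: clear_fraction.
exists F; split=> //.
rewrite /root horner_size3; last by rewrite (leq_trans (size_map_of_poly _)) ?sF.
rewrite !coef_map /= e0 e1 !rmorphM /=; have := coord_quadratic A B.
move: (ofr A + ofr B * Y) (ofr B) (ofr (coord_norm A B)) (ofr (F`_2)%:F) => z b' n' g' /= e.
by apply/eqP; exact: scaled_quadratic e.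
Qed.

(** Holds because 1 and y are independent over k(x); it provides the minimality hypothesis of
    [primitive_relation_sizeY]. *)
Lemma irrational_minimal A B (R : {poly {poly k}}) :
  B != 0 -> (size R < 3)%N -> root (map_poly of_poly R) (ofr A + ofr B * Y) -> R = 0.
Proof.
move=> B0 sR; rewrite (size2_polyE sR) rmorphD rmorphM /= !map_polyC map_polyX /root !hornerE /=.
move=> /eqP e; have [] := @Kabcd_coord_eq0 _ r a b c d a0 ((R`_0)%:F + (R`_1)%:F * A) ((R`_1)%:F * B).
  by rewrite -[RHS]e !rmorphD !rmorphM /=; ring.
move=> + /eqP; rewrite mulf_eq0 (negPf B0) orbF => /[swap].
rewrite tofrac_eq0 => /eqP->; rewrite tofrac0 mul0r addr0 => /eqP.
by rewrite tofrac_eq0 => /eqP->; rewrite mul0r addr0.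
Qed.

End Relations.

(** * Artin-Schreier identities, and substitution for x *)

Lemma rhs_quad (k : fieldType) (r a b c d : k) :
  rhs r a b c d * (quad r)%:F = (rhs_num r a b c d)%:F.
Proof.
have eq : (quad r)%:F = ratx k ^+ 2 + ratx k + ratC r.
  by rewrite /quad !rmorphD /= rmorphXn.
have q0 : (quad r)%:F != 0 by rewrite tofrac_eq0 quad_neq0.
rewrite /rhs_num -!mul_polyC !(tofracD, tofracM) -/(ratx k).
rewrite -/(ratC a) -/(ratC b) -/(ratC c) -/(ratC d) /rhs -eq.
move: (ratC a) (ratC b) (ratC c) (ratC d) (ratx k) ((quad r)%:F) q0 => A B C D x q q0.
by rewrite -clear_denom.
Qed.

(** Norm over squared trace is the Artin-Schreier parameter attached to the generator A + B y; it
    differs from w = y^2 + y by v^2 + v with v = A / B. *)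
Lemma norm_trace_AS (F : fieldType) (A B w : F) : B != 0 ->
  A ^+ 2 + A * B + B ^+ 2 * w = B ^+ 2 * (w + (A / B) ^+ 2 + A / B).
Proof. by move=> B0; field. Qed.

Lemma AS_cleared (F : fieldType) (m d w n q p s : F) : s != 0 -> w * q = n ->
  m = d * (w + (p / s) ^+ 2 + p / s) ->
  m * s ^+ 2 * q = d * (n * s ^+ 2 + p * (p + s) * q).
Proof. by move=> s0 <- ->; field. Qed.

Lemma AS_cleared_poly (k : fieldType) (w : {fraction {poly k}}) (M D p s N q : {poly k}) :
  s != 0 -> w * q%:F = N%:F -> M%:F = D%:F * (w + (p%:F / s%:F) ^+ 2 + p%:F / s%:F) ->
  M * s ^+ 2 * q = D * (N * s ^+ 2 + p * (p + s) * q).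
Proof.
rewrite -tofrac_eq0 => s0 eN eM; apply/eqP; rewrite -tofrac_eq.
rewrite !(tofracD, tofracM, tofracXn); apply/eqP; move: s0 eN eM.
move: (p%:F) (s%:F) (q%:F) (M%:F) (D%:F) (N%:F) => p1 s1 q1 M1 D1 N1.
exact: AS_cleared.
Qed.

(** A relation G(x_L, z) between x_L and z is carried by [u] to one between u(x_L) and x_K. Swapping
    the variables lets it be read as a relation for u(x_L) with coefficients in k[x_K]. *)
Lemma horner_swap_map (k : fieldType) (L K : comNzRingType) (evL : {rmorphism {poly k} -> L})
    (evK : {rmorphism {poly k} -> K}) (u : {rmorphism L -> K}) (z : L) (G : {poly {poly k}}) :
  (forall e, u (evL e%:P) = evK e%:P) -> u z = evK 'X ->
  (map_poly evK (swapXY G)).[u (evL 'X)] = u (map_poly evL G).[z].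
Proof.
move=> uC uz; have eC (g : {poly k}) : (map_poly evK (map_poly polyC g)).[u (evL 'X)] = u (evL g).
  elim/poly_ind: g => [|g e IHg]; first by rewrite !rmorph0 horner0.
  by rewrite !rmorphD !rmorphM /= hornerD hornerM IHg !map_polyX hornerX !map_polyC hornerC uC.
elim/poly_ind: G => [|G g IHG]; first by rewrite !rmorph0 !horner0 rmorph0.
rewrite !rmorphD !rmorphM /= !hornerD !hornerM IHG swapXY_X swapXY_polyC eC.
by rewrite !map_polyX hornerX !map_polyC !hornerC !rmorphD !rmorphM /= uz.
Qed.

Definition rhs_at (k : fieldType) (r a b c d : k) (f : {fraction {poly k}}) :=
  ratC a * f + (ratC b * f + ratC c) / (f ^+ 2 + f + ratC r) + ratC d.

Section Substitution.
Context {k K : fieldType} (tau sigma : {rmorphism {fraction {poly k}} -> K}).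
Context (f : {fraction {poly k}}).
Hypothesis tauC : forall e, tau (ratC e) = sigma (ratC e).
Hypothesis tauX : tau (ratx k) = sigma f.

Lemma rhs_substE r a b c d : tau (rhs r a b c d) = sigma (rhs_at r a b c d f).
Proof. by rewrite /rhs /rhs_at !(rmorphD, rmorphM, fmorphV, rmorphXn) /= !tauC tauX. Qed.

Lemma quad_substE r : tau (quad r)%:F = sigma (f ^+ 2 + f + ratC r).
Proof.
rewrite /quad !tofracD tofracXn -/(ratx k) -/(ratC r).
by rewrite !(rmorphD, rmorphXn) /= !tauC tauX.
Qed.

Lemma ratfun_subst_range A : exists A', tau A = sigma A'.
Proof.
have pol (p : {poly k}) : exists A', tau p%:F = sigma A'.
  elim/poly_ind: p => [|p e [A' IHp]]; first by exists 0; rewrite tofrac0 !rmorph0.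
  exists (A' * f + ratC e).
  by rewrite tofracD tofracM -/(ratx k) -/(ratC e) !rmorphD !rmorphM /= IHp tauC tauX.
have [[p s] /= s0 ->] := fractionE A.
have [P eP] := pol p; have [S eS] := pol s; exists (P / S).
by rewrite !rmorphM !fmorphV /= eP eS.
Qed.

End Substitution.

Lemma pchar2_AS_expand (R : comNzRingType) (A B y w : R) : 2%N \in [pchar R] ->
  y ^+ 2 + y = w ->
  (A + B * y) ^+ 2 + (A + B * y) = A ^+ 2 + A + B ^+ 2 * w + (B ^+ 2 + B) * y.
Proof.
move=> /pcharf0 two0 <-.
have -> : A ^+ 2 + A + B ^+ 2 * (y ^+ 2 + y) + (B ^+ 2 + B) * y =
  (A + B * y) ^+ 2 + (A + B * y) + 2%:R * (B ^+ 2 * y - A * B * y) by ring.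
by rewrite two0 mul0r addr0.
Qed.

Lemma quad_at_fraction (F : fieldType) (p r s : F) : s != 0 ->
  (p / s) ^+ 2 + p / s + r = (p ^+ 2 + p * s + r * s ^+ 2) / s ^+ 2.
Proof. by move=> s0; field. Qed.

Lemma rhs_at_fraction (F : fieldType) (a b c d r p s : F) (q := p ^+ 2 + p * s + r * s ^+ 2) :
  s != 0 -> q != 0 ->
  a * p * q + (b * p + c * s) * s ^+ 2 + d * s * q =
  s * q * (a * (p / s) + (b * (p / s) + c) / ((p / s) ^+ 2 + p / s + r) + d).
Proof.
by move=> s0 q0; rewrite quad_at_fraction // -/q; move: q q0 => q q0; field; rewrite s0.
Qed.

Lemma rhs_fieldB (F : fieldType) (a b c d a' b' c' d' x q : F) :
  (a * x + (b * x + c) / q + d) - (a' * x + (b' * x + c') / q + d') =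
  (a - a') * x + ((b - b') * x + (c - c')) / q + (d - d').
Proof.
have -> : (b - b') * x + (c - c') = (b * x + c) - (b' * x + c') by ring.
by rewrite (mulrBl q^-1); ring.
Qed.

Lemma coefs_linear (R : nzRingType) (p s : R) :
  forall i, (s%:P * 'X + (- p)%:P)`_i = if i == 0%N then - p else if i == 1%N then s else 0.
Proof. by move=> [|[|i]]; rewrite coefD coefMX !coefC /= ?add0r ?addr0. Qed.

(** Since beta^2 + beta = 0, the translation fixes x^2 + x + r, so only [c] and [d] change; beta = 1
    gives the action of [shift] on parameters. *)
Lemma rhs_at_shift (k : fieldType) (k2 : 2%N \in [pchar k]) (r a b c d beta : k) :
  (beta == 0) || (beta == 1) ->
  rhs_at r a b c d (ratx k + ratC beta) = rhs r a b (b * beta + c) (a * beta + d).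
Proof.
move=> beta01; have e : ratC beta ^+ 2 + ratC beta = 0.
  rewrite expr2 /ratC -tofracM -tofracD -polyCM -polyCD.
  suff -> : beta * beta + beta = 0 by rewrite polyC0 tofrac0.
  by case/orP: beta01 => /eqP->; rewrite ?mulr0 ?addr0 ?mulr1 ?(addrr_pchar2 k2).
have two0 := pcharf0 (pchar_ratfun k2).
rewrite /rhs_at /rhs.
have -> : (ratx k + ratC beta) ^+ 2 + (ratx k + ratC beta) + ratC r =
    ratx k ^+ 2 + ratx k + ratC r.
  transitivity (ratx k ^+ 2 + ratx k + ratC r + (ratC beta ^+ 2 + ratC beta) + 2%:R * (ratx k * ratC beta)).
    by move: (ratx k) (ratC beta) (ratC r) => x y z; ring.
  by rewrite e two0 mul0r !addr0.
have -> : ratC (b * beta + c) = ratC b * ratC beta + ratC c.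
  by rewrite /ratC polyCD polyCM tofracD tofracM.
have -> : ratC (a * beta + d) = ratC a * ratC beta + ratC d.
  by rewrite /ratC polyCD polyCM tofracD tofracM.
move: (ratx k) (ratC beta) (ratC a) (ratC b) (ratC c) (ratC d) (_ + ratC r) => x y A B C D q.
ring.
Qed.

(** * The shape of an isomorphism of function fields *)

Section Iso.
Context {k : fieldType} (k2 : 2%N \in [pchar k]) (r : k) (r_notin_AS : ~~ AS k2 r).
Context (a b c d : k) (a0 : a != 0) (a' b' c' d' : k) (a'0 : a' != 0).
Context (bc0' : (b', c') != (0, 0)).
Local Notation L := (Kabcd r b c d a0).
Local Notation K := (Kabcd r b' c' d' a'0).
Local Notation ofL := (of_ratfun r b c d a0).
Local Notation ofK := (of_ratfun r b' c' d' a'0).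
Local Notation XL := (coord_x r b c d a0).
Local Notation XK := (coord_x r b' c' d' a'0).
Local Notation YL := (coord_y r b c d a0).
Local Notation YK := (coord_y r b' c' d' a'0).
Local Notation evL := (of_poly r b c d a0).
Local Notation evK := (of_poly r b' c' d' a'0).
Context (u : {rmorphism L -> K}) (uC : forall e, u (const_abcd r b c d a0 e) = const_abcd r b' c' d' a'0 e).

Lemma swap_relation (z : L) (G : {poly {poly k}}) : u z = XK ->
  (map_poly evK (swapXY G)).[u XL] = u (map_poly evL G).[z].
Proof. by move=> uz; exact (@horner_swap_map k L K evL evK u z G uC uz). Qed.

(** The swapped [G] is a relation for u(x_L) whose degree in x_K is the degree of [G] in z, and the
    primitive relation [F] divides it. *)
Lemma image_relation_sizeY (z : L) (F G : {poly {poly k}}) :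
  u z = XK -> primitive_coefs F -> F != 0 -> root (map_poly evK F) (u XL) ->
  (forall R : {poly {poly k}}, (size R < size F)%N -> root (map_poly evK R) (u XL) -> R = 0) ->
  G != 0 -> root (map_poly evL G) z -> (sizeY F <= size G)%N.
Proof.
move=> uz primF F0 Fz minF G0 Gz; have -> : size G = sizeY (swapXY G) by rewrite sizeYE swapXYK.
apply: (primitive_relation_sizeY primF F0 Fz minF); first by rewrite swapXY_eq0.
by apply/rootP; rewrite (swap_relation G uz) (rootP Gz); exact: (rmorph0 u).
Qed.

(* If u(x) = A + B y with B <> 0, then u(x) and x satisfy a relation of bidegree (2, 2), and
   its three coefficients P_i give the quadratic extension the Artin-Schreier parameter
   P_0 P_2 / P_1^2: that fraction cannot have poles both at [quad] and at infinity. *)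
Lemma image_x_rational (z : L) : u z = XK -> exists f, u XL = ofK f.
Proof.
move=> uz; have [A [B eu]] := Kabcd_coord (u XL).
have [B0|B0] := eqVneq B 0; first by exists A; rewrite eu B0 rmorph0 mul0r addr0.
have [C [D ez]] := Kabcd_coord z.
have [G [sG _ Gz _ _]] := coord_relation k2 r b c d a0 C D.
have [F [sF primF Fz eF1 eF0]] := coord_relation k2 r b' c' d' a'0 A B.
have G0 : G != 0 by rewrite -size_poly_eq0 sG.
have F0 : F != 0 by rewrite -size_poly_eq0 sF.
have sYF : (sizeY F <= 3)%N.
  rewrite -sG; apply: (image_relation_sizeY uz primF F0 _ _ G0).
  - by rewrite eu.
  - by move=> R; rewrite sF eu; exact: irrational_minimal.
  - by rewrite ez.
have sFi i : (size (F`_i)%R <= 3)%N := leq_trans (max_size_coefXY F i) sYF.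
have F20 : F`_2 != 0 by have := lead_coef_eq0 F; rewrite lead_coefE sF /= (negPf F0) => ->.
have F20F : (F`_2)%:F != 0 by rewrite tofrac_eq0.
have F10 : F`_1 != 0 by rewrite -tofrac_eq0 eF1 (mulf_neq0 F20F B0).
have [p [s [s0 cps ev]]] := fraction_coprimeE (A / B).
(* P_0 P_2 / P_1^2 is norm over squared trace of u(x_L), that is [rhs] + v^2 + v with v = A / B. *)
have [] := @AS_equivalent_poles _ _ r r_notin_AS a' b' c' d' (F`_0 * F`_2) (F`_1 ^+ 2) p s.
- by [].
- by [].
- by rewrite expf_neq0.
- by [].
- by [].
- apply: (AS_cleared_poly s0 (rhs_quad r a' b' c' d')).
  rewrite tofracM tofracXn eF0 eF1 -ev /coord_norm (norm_trace_AS _ _ B0).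
  by move: (rhs r a' b' c' d') (A / B) ((F`_2)%:F) (B) => w v g B1; ring.
- move=> /(quad_prime r_notin_AS).
  rewrite orbb => /(dvdp_leq F10); rewrite size_quad => s1.
  rewrite ltnNge => /negP[]; rewrite expr2 (size_mul F10 F10).
  apply: (leq_trans (size_polyMleq _ _)); have := sFi 0%N; have := sFi 2%N; move: s1; clear.
  by move: (size (F`_2)%R) (size (F`_1)%R) (size (F`_0)%R) => x y t; lia.
Qed.

(* Both u(x) and its inverse are rational functions, so they satisfy a relation of bidegree (1, 1). *)
Lemma image_x_linear (g : {fraction {poly k}}) : u (ofL g) = XK ->
  exists p s : {poly k}, [/\ s != 0, (size p <= 2)%N, (size s <= 2)%N & u XL = ofK (p%:F / s%:F)].
Proof.
move=> ug; have [f uX] := image_x_rational ug.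
have [p [s [s0 cps ef]]] := fraction_coprimeE f.
have [[g1 g2] /= g20 eg] := fractionE g.
pose F : {poly {poly k}} := s%:P * 'X + (- p)%:P.
pose G : {poly {poly k}} := g2%:P * 'X + (- g1)%:P.
have sF : size F = 2%N by rewrite size_MXaddC polyC_eq0 (negPf s0) size_polyC s0.
have sG : size G = 2%N by rewrite size_MXaddC polyC_eq0 (negPf g20) size_polyC g20.
have F0 : F != 0 by rewrite -size_poly_eq0 sF.
have G0 : G != 0 by rewrite -size_poly_eq0 sG.
have rootE (E : fieldType) (h : {rmorphism {fraction {poly k}} -> E}) (p1 s1 : {poly k}) : s1 != 0 ->
    root (map_poly (h \o @FracField.tofrac {poly k}) (s1%:P * 'X + (- p1)%:P)) (h (p1%:F / s1%:F)).
  move=> s10; rewrite rmorphD rmorphM /= !map_polyC map_polyX /root hornerD hornerM !hornerC hornerX /=.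
  rewrite -rmorphM rmorphN /= rmorphN /=.
  have -> : s1%:F * (p1%:F / s1%:F) = p1%:F by rewrite mulrC mulfVK // tofrac_eq0.
  by rewrite subrr.
have sY : (sizeY F <= 2)%N.
  rewrite -sG; apply: (image_relation_sizeY ug _ F0 _ _ G0).
  - move=> h hF; have := cps; rewrite /coprimep => /eqP <-; apply: dvdp_leq.
      by rewrite gcdp_eq0 negb_and s0 orbT.
    have := hF 0%N; have := hF 1%N; rewrite !coefs_linear /= dvdpNr dvdp_gcd.
    by move=> -> ->.
  - by rewrite uX ef; exact: rootE.
  - move=> R; rewrite sF ltnS => /size1_polyC ->; rewrite map_polyC /root hornerC.
    by rewrite fmorph_eq0 /= tofrac_eq0 => /eqP ->.
  - by rewrite eg; exact: rootE.
have := leq_trans (max_size_coefXY F 1) sY; rewrite coefs_linear => ss.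
have := leq_trans (max_size_coefXY F 0) sY; rewrite coefs_linear size_polyN => sp.
by exists p, s; rewrite uX ef.
Qed.

Let tau : {rmorphism {fraction {poly k}} -> K} := u \o ofL.

(** Write u(y_L) = A + B y_K. Its Artin-Schreier equation has a rational right-hand side, so B^2 + B
    = 0; and B = 0 would put the whole image of [u] in k(x_K), although y_K is in the image. *)
Lemma image_y_shape (f : {fraction {poly k}}) (y1 : L) :
  u XL = ofK f -> u y1 = YK ->
  exists2 A, u YL = YK + ofK A & rhs_at r a b c d f = rhs r a' b' c' d' + A ^+ 2 + A.
Proof.
move=> uX uy1; have [A [B uY]] := Kabcd_coord (u YL).
have eW : u YL ^+ 2 + u YL = ofK (rhs_at r a b c d f).
  rewrite -rmorphXn -rmorphD /= coord_eqn.
  exact: (@rhs_substE k K tau ofK f uC uX).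
have := pchar2_AS_expand (ofK A) (ofK B) (pchar_K k2 r b' c' d' a'0) (coord_eqn r b' c' d' a'0).
rewrite -uY eW => e.
have [] := @Kabcd_coord_inj k r a' b' c' d' a'0 (rhs_at r a b c d f) 0
  (A ^+ 2 + A + B ^+ 2 * rhs r a' b' c' d') (B ^+ 2 + B).
  rewrite rmorph0 mul0r addr0 e; clear; move: (rhs _ _ _ _ _) => w'.
  have -> : ofK (A ^+ 2 + A + B ^+ 2 * w') = ofK A ^+ 2 + ofK A + ofK B ^+ 2 * ofK w'.
    by rewrite !rmorphD rmorphM !rmorphXn.
  by have -> : ofK (B ^+ 2 + B) = ofK B ^+ 2 + ofK B by rewrite rmorphD rmorphXn.
move=> eWA /esym/eqP; rewrite addr_eq0 (oppr_pchar2 (pchar_ratfun k2)) => /eqP eB.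
have [B0|B0] := eqVneq B 0.
  have [C [D ey1]] := Kabcd_coord y1.
  have [C' eC] := @ratfun_subst_range k K tau ofK f uC uX C.
  have [D' eD] := @ratfun_subst_range k K tau ofK f uC uX D.
  case: (@Y_notin_ratfun k r a' b' c' d' a'0 (C' + D' * A)).
  rewrite -uy1 ey1 rmorphD rmorphM /= uY B0 rmorph0 mul0r addr0 [RHS]rmorphD [X in _ = _ + X]rmorphM.
  by congr (_ + _ * _); [exact: eC | exact: eD].
have B1 : B = 1 by apply: (mulfI B0); rewrite -expr2 eB mulr1.
exists A; first by rewrite uY B1 rmorph1 mul1r addrC.
by rewrite eWA B1 expr1n mul1r addrAC [in RHS]addrAC [RHS]addrC addrA -addrA [X in _ + X]addrC.
Qed.

(** Surjectivity of [u] enters only through the given preimages of x_K and y_K. *)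
Lemma iso_shape (g : {fraction {poly k}}) (y1 : L) :
  u (ofL g) = XK -> u y1 = YK ->
  exists beta e : k,
    [/\ (beta == 0) || (beta == 1), u XL = ofK (ratx k + ratC beta), u YL = YK + ofK (ratC e) &
        [/\ a = a', b = b', b * beta + c = c' & a * beta + d - d' = e + e ^+ 2]].
Proof.
move=> ug uy1; have [p [s [s0 sp ss uX]]] := image_x_linear ug.
have [A uY eW] := image_y_shape uX uy1.
have [p1 [s1 [s10 cps eA]]] := fraction_coprimeE A.
pose qf := p ^+ 2 + p * s + r *: s ^+ 2.
have sF0 : s%:F != 0 by rewrite tofrac_eq0.
have eqf : qf%:F = p%:F ^+ 2 + p%:F * s%:F + ratC r * s%:F ^+ 2.
  by rewrite /qf -mul_polyC !expr2 !tofracD !tofracM.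
(* [qf / s^2] has the same image in K as the nonzero element [quad] of k(x_L). *)
have qf0 : qf != 0.
  have : ofK ((p%:F / s%:F) ^+ 2 + p%:F / s%:F + ratC r) != 0.
    have <- := @quad_substE k K tau ofK _ uC uX r.
    by rewrite fmorph_eq0 tofrac_eq0 quad_neq0.
  rewrite fmorph_eq0; apply: contraNneq => q0.
  have : qf%:F = 0 by rewrite q0 tofrac0.
  rewrite eqf; move: (p%:F) (s%:F) (ratC r) sF0 => P S R S0 e.
  by rewrite (quad_at_fraction P R S0) e mul0r.
(* [M / (s * qf)] is the right-hand side of the equation of L at p / s. *)
pose M := a *: p * qf + (b *: p + c *: s) * s ^+ 2 + d *: s * qf.
have eM : M%:F = (s * qf)%:F * (rhs r a' b' c' d' + (p1%:F / s1%:F) ^+ 2 + p1%:F / s1%:F).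
  rewrite -eA -eW /rhs_at.
  have -> : M%:F = ratC a * p%:F * qf%:F + (ratC b * p%:F + ratC c * s%:F) * s%:F ^+ 2
      + ratC d * s%:F * qf%:F.
    by rewrite /M -!mul_polyC; move: (qf) => q'; rewrite !expr2 !(tofracD, tofracM).
  have qF0 : qf%:F != 0 by rewrite tofrac_eq0.
  rewrite tofracM; move: qF0; rewrite eqf; move: sF0.
  move: (p%:F) (s%:F) (ratC r) (ratC a) (ratC b) (ratC c) (ratC d) => P S R A1 B1 C1 D1.
  exact: rhs_at_fraction.
have [qD lt] : quad r %| s * qf /\ (size (s * qf)%R < size M)%N.
  apply: (AS_equivalent_poles r_notin_AS a'0 bc0' _ s10 cps (AS_cleared_poly s10 (rhs_quad r a' b' c' d') eM)).
  exact: mulf_neq0.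
have [beta [beta01 ep]] := pole_preserving r_notin_AS sp ss s0 qf0 qD lt.
have ef : p%:F / s%:F = ratx k + ratC beta.
  by rewrite ep tofracM tofracD mulfK.
(* [rhs] is additive in its four parameters, so the two right-hand sides differ by a third one,
   equal to A^2 + A; [AS_rhs_trivial] then forces A to be constant. *)
have eR : rhs r (a - a') (b - b') (b * beta + c - c') (a * beta + d - d') = (p1%:F / s1%:F) ^+ 2 + p1%:F / s1%:F.
  move: eW; rewrite ef (rhs_at_shift k2) // -eA => eW.
  have -> : A ^+ 2 + A = rhs r a b (b * beta + c) (a * beta + d) - rhs r a' b' c' d'.
    by rewrite eW; move: (rhs _ _ _ _ _) (A) => x y; ring.
  rewrite /rhs rhs_fieldB.
  by rewrite /ratC !polyCB !tofracB.
have eN : p1 * (p1 + s1) * quad r =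
      s1 ^+ 2 * rhs_num r (a - a') (b - b') (b * beta + c - c') (a * beta + d - d').
  have := rhs_quad r (a - a') (b - b') (b * beta + c - c') (a * beta + d - d').
  rewrite eR => e; apply/eqP; rewrite -tofrac_eq; apply/eqP.
  rewrite (tofracM _ (quad r)) (tofracM p1) (tofracD p1) (tofracM (s1 ^+ 2)) tofracXn -e.
  have s1F0 : s1%:F != 0 by rewrite tofrac_eq0.
  move: (p1%:F) (s1%:F) ((quad r)%:F) s1F0 => P S Q S0; exact: clear_square.
have [e [ea eb ec ed ep1]] := AS_rhs_trivial r_notin_AS s10 cps eN.
exists beta, e; split=> //.
- by rewrite uX ef.
- have s1F0 : s1%:F != 0 by rewrite tofrac_eq0.
  by rewrite uY eA ep1 -mul_polyC tofracM (mulfK s1F0).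
- by split=> //; apply/eqP; rewrite -subr_eq0 ?ea ?eb ?ec.
Qed.

End Iso.

(** * Construction of isomorphisms of function fields *)

Lemma pchar2_AS_add (R : comNzRingType) (x y : R) : 2%N \in [pchar R] ->
  (x + y) ^+ 2 + (x + y) = x ^+ 2 + x + (y ^+ 2 + y).
Proof.
move=> /pcharf0 two0.
have -> : x ^+ 2 + x + (y ^+ 2 + y) = (x + y) ^+ 2 + (x + y) - 2%:R * (x * y) by ring.
by rewrite two0 mul0r subr0.
Qed.

Lemma pchar2_shiftK (L K : fieldType) (u : {rmorphism L -> K}) (w : {rmorphism K -> L})
    (x s : L) (y t : K) :
  2%N \in [pchar L] -> u x = y + t -> w y = x + s -> w t = s -> w (u x) = x.
Proof. by move=> L2 -> wy wt; rewrite rmorphD wy wt -addrA (addrr_pchar2 L2) addr0. Qed.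

Section Homs.
Context {k : fieldType} (k2 : 2%N \in [pchar k]) (r : k).

Lemma Kabcd_ext (b c d a : k) (a0 : a != 0) (F : fieldType) (u v : {rmorphism Kabcd r b c d a0 -> F}) :
  (forall e, u (const_abcd r b c d a0 e) = v (const_abcd r b c d a0 e)) ->
  u (coord_x r b c d a0) = v (coord_x r b c d a0) ->
  u (coord_y r b c d a0) = v (coord_y r b c d a0) -> u =1 v.
Proof.
move=> uvC uvX uvY z; have [A [B ->]] := Kabcd_coord z.
have uvp : (u \o of_poly r b c d a0) =1 (v \o of_poly r b c d a0) :=
  @of_poly_ext k F (u \o of_poly r b c d a0) (v \o of_poly r b c d a0) uvC uvX.
have uvr C : u (of_ratfun r b c d a0 C) = v (of_ratfun r b c d a0 C).
  have [[p s] /= _ ->] := fractionE C.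
  have up : u (of_ratfun r b c d a0 p%:F) = v (of_ratfun r b c d a0 p%:F) := uvp p.
  have us : u (of_ratfun r b c d a0 s%:F) = v (of_ratfun r b c d a0 s%:F) := uvp s.
  by rewrite !rmorphM !fmorphV /= up us.
by rewrite !rmorphD !rmorphM /= !uvr uvY.
Qed.

(** Substitution of x + beta is extended from k[x] to k(x), and then to the function field: y + e
    satisfies the substituted equation because e + e^2 makes up for the change in the constant
    term. *)
Lemma Kabcd_shift_hom (a b c d : k) (a0 : a != 0) (a' b' c' d' : k) (a'0 : a' != 0) (beta e : k) :
  (beta == 0) || (beta == 1) ->
  a = a' -> b = b' -> b * beta + c = c' -> a * beta + d - d' = e + e ^+ 2 ->
  exists u : {rmorphism Kabcd r b c d a0 -> Kabcd r b' c' d' a'0},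
    [/\ forall x, u (const_abcd r b c d a0 x) = const_abcd r b' c' d' a'0 x,
        u (coord_x r b c d a0) = coord_x r b' c' d' a'0 + const_abcd r b' c' d' a'0 beta &
        u (coord_y r b c d a0) = coord_y r b' c' d' a'0 + const_abcd r b' c' d' a'0 e].
Proof.
move=> beta01 ea eb ec ed.
pose K := Kabcd r b' c' d' a'0.
pose f : {rmorphism {poly k} -> {fraction {poly k}}} :=
  @FracField.tofrac {poly k} \o comp_poly ('X + beta%:P).
have f_inj : injective f.
  move=> p q /eqP; rewrite /= tofrac_eq => /eqP e1.
  have := congr1 (comp_poly ('X - beta%:P)) e1.
  by rewrite -!comp_polyA comp_polyD comp_polyX comp_polyC subrK !comp_polyXr.
have [g gE] := fraction_lift f_inj.
have gC x : g (ratC x) = ratC x by rewrite gE /= comp_polyC.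
have gX : g (ratx k) = ratx k + ratC beta by rewrite gE /= comp_polyX tofracD.
pose h : {rmorphism {fraction {poly k}} -> K} := of_ratfun r b' c' d' a'0 \o g.
pose y : K := coord_y r b' c' d' a'0 + const_abcd r b' c' d' a'0 e.
have ey : y ^+ 2 + y = h (rhs r a b c d).
  have -> : h (rhs r a b c d) = of_ratfun r b' c' d' a'0 (rhs r a' b' c' (a * beta + d)).
    congr (of_ratfun _ _ _ _ _ _); rewrite -ea -eb -ec -(rhs_at_shift k2) //.
    exact: (@rhs_substE k _ g idfun _ gC gX).
  have -> : rhs r a' b' c' (a * beta + d) = rhs r a' b' c' d' + (ratC e ^+ 2 + ratC e).
    have -> : a * beta + d = d' + (e + e ^+ 2) by rewrite -ed [d' + _]addrC subrK.
    rewrite /rhs -[RHS]addrA; congr (_ + _).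
    by rewrite /ratC [e + _]addrC !polyCD !tofracD !expr2 polyCM tofracM.
  have := pchar_K k2 r b' c' d' a'0.
  have : of_ratfun r b' c' d' a'0 (rhs r a' b' c' d' + (ratC e ^+ 2 + ratC e)) =
      coord_y r b' c' d' a'0 ^+ 2 + coord_y r b' c' d' a'0 +
      (const_abcd r b' c' d' a'0 e ^+ 2 + const_abcd r b' c' d' a'0 e).
    by rewrite rmorphD coord_eqn [X in _ + X]rmorphD rmorphXn.
  move=> ->; rewrite /y; move: (coord_y _ _ _ _ _) (const_abcd _ _ _ _ _ _) => Y E two0.
  exact (pchar2_AS_add Y E two0).
have [u [uE uY]] := Kabcd_lift a0 ey.
exists u; split=> //.
- move=> x; rewrite /const_abcd uE /h /=; congr (of_ratfun r b' c' d' a'0 _); exact: gC.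
- rewrite /coord_x uE /h /= gX; exact: (rmorphD (of_ratfun r b' c' d' a'0)).
Qed.

(** In characteristic two translations are involutions, so the inverse is given by the same [beta]
    and [e] with the two curves exchanged. *)
Lemma Kabcd_shift_iso (a b c d : k) (a0 : a != 0) (a' b' c' d' : k) (a'0 : a' != 0) (beta e : k) :
  (beta == 0) || (beta == 1) ->
  a = a' -> b = b' -> b * beta + c = c' -> a * beta + d - d' = e + e ^+ 2 ->
  exists (u : {rmorphism Kabcd r b c d a0 -> Kabcd r b' c' d' a'0})
         (w : {rmorphism Kabcd r b' c' d' a'0 -> Kabcd r b c d a0}),
    [/\ forall x, u (const_abcd r b c d a0 x) = const_abcd r b' c' d' a'0 x,
        u (coord_x r b c d a0) = coord_x r b' c' d' a'0 + const_abcd r b' c' d' a'0 beta,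
        u (coord_y r b c d a0) = coord_y r b' c' d' a'0 + const_abcd r b' c' d' a'0 e &
        [/\ forall x, w (const_abcd r b' c' d' a'0 x) = const_abcd r b c d a0 x,
            cancel u w & cancel w u]].
Proof.
move=> beta01 ea eb ec ed.
have [u [uC uX uY]] := Kabcd_shift_hom a0 a'0 beta01 ea eb ec ed.
have ec' : b' * beta + c' = c by rewrite -ec -eb addrA (addrr_pchar2 k2) add0r.
have ed' : a' * beta + d' - d = e + e ^+ 2.
  by rewrite -ed -ea !(oppr_pchar2 k2) addrAC.
have [w [wC wX wY]] := Kabcd_shift_hom a'0 a0 beta01 (esym ea) (esym eb) ec' ed'.
exists u, w; split; [exact: uC|exact: uX|exact: uY|split; first exact: wC].
- apply: (@Kabcd_ext _ _ _ _ _ _ (w \o u) idfun) => [x||].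
  + exact (etrans (f_equal w (uC x)) (wC x)).
  + exact (pchar2_shiftK (pchar_K k2 r b c d a0) uX wX (wC beta)).
  + exact (pchar2_shiftK (pchar_K k2 r b c d a0) uY wY (wC e)).
- apply: (@Kabcd_ext _ _ _ _ _ _ (u \o w) idfun) => [x||].
  + exact (etrans (f_equal u (wC x)) (uC x)).
  + exact (pchar2_shiftK (pchar_K k2 r b' c' d' a'0) wX uX (uC beta)).
  + exact (pchar2_shiftK (pchar_K k2 r b' c' d' a'0) wY uY (uC e)).
Qed.

End Homs.

(** * Curve morphisms and homomorphisms of function fields *)

Local Open Scope classical_set_scope.

Section CurveHoms.
Context {k : fieldType}.
Implicit Types K L : function_field k.

Lemma regular_locus_open K (f : K) : open (regular_locus f).
Proof.
exists [set regular_locus f]; last by rewrite bigcup_set1.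
by move=> _ ->; apply: (@finI_from1 _ _ _ id); exists f.
Qed.

(** Open sets are unions of finite intersections of regular loci, so it suffices to test these
    loci. *)
Lemma curve_continuous K L (h : curve K -> curve L) :
  (forall f : L, open (h @^-1` regular_locus f)) -> continuous h.
Proof.
move=> ho; apply/continuousP => _ [D' sD' <-].
rewrite preimage_bigcup; apply: bigcup_open => B /sD'[E sE <-].
rewrite preimage_bigcap bigcap_fset big_seq_cond; apply: big_ind; first exact: openT.
  by move=> U V; exact: openI.
move=> U /andP[/sE + _]; rewrite inE => -[f _ <-]; exact: ho.
Qed.

Lemma comap_valuation_ring K L (u : {rmorphism L -> K}) (P : curve K) :
  (forall e, u (ff_const L e) = ff_const K e) ->
  valuation_ring [set f | local_ring P (u f)].
Proof.
move=> uC; have [hC hB hM hV] := local_ringP P; split=> [e|f g|f g|f] /=.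
- by rewrite uC.
- by rewrite rmorphB; exact: hB.
- by rewrite rmorphM; exact: hM.
- by rewrite fmorphV; exact: hV.
Qed.

Definition comap_point K L (u : {rmorphism L -> K})
    (uC : forall e, u (ff_const L e) = ff_const K e) (P : curve K) : curve L :=
  CurvePoint (comap_valuation_ring P uC).

Lemma curve_hom_of_rmorphism K L (u : {rmorphism L -> K}) :
  (forall e, u (ff_const L e) = ff_const K e) ->
  exists phi : curve_hom K L, pullback phi = u /\
    forall P, local_ring (phi P) = [set f | local_ring P (u f)].
Proof.
move=> uC; have cont : continuous (comap_point uC).
  apply: curve_continuous => f; rewrite [X in open X](_ : _ = regular_locus (u f)) //.
  exact: regular_locus_open.
have uB : zmod_morphism u by move=> x y; exact: rmorphB.
have uM : monoid_morphism u by split; [exact: rmorph1 | move=> x y; exact: rmorphM].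
have reg U : open U -> forall f, regular_on U f -> regular_on (comap_point uC @^-1` U) (u f).
  by move=> _ f rf P /rf.
by exists (CurveHom cont uB uM uC reg).
Qed.

Lemma pullback_rmorphism K L (phi : curve_hom K L) :
  exists u : {rmorphism L -> K}, pullback phi = u.
Proof.
by exists (HB.pack_for {rmorphism L -> K} (pullback phi)
  (GRing.isZmodMorphism.Build _ _ _ (@pullback_sub _ _ _ phi))
  (GRing.isMonoidMorphism.Build _ _ _ (@pullback_mul _ _ _ phi))).
Qed.

Lemma curve_point_eq K (P Q : curve K) : local_ring P = local_ring Q -> P = Q.
Proof.
by case: P Q => [O hO] [O' hO'] /= e; case: _ / e hO' => hO'; congr CurvePoint; exact: Prop_irrelevance.
Qed.

Lemma local_ring_pullback K L (phi : curve_hom K L) P (f : L) :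
  local_ring (phi P) f -> local_ring P (pullback phi f).
Proof.
exact: (@pullback_regular _ _ _ phi _ (regular_locus_open f) f (fun _ => id) P).
Qed.

Lemma pullback_compK K L (phi : curve_hom K L) (psi : curve_hom L K) :
  curve_comp psi phi = curve_id K -> cancel (pullback psi) (pullback phi).
Proof. by move=> psiK z; exact: (congr1 (fun h : curve_hom K K => pullback h z) psiK). Qed.

Lemma curve_iso_rmorphism K L (phi : curve_hom K L) (psi : curve_hom L K) :
  curve_comp psi phi = curve_id K -> curve_comp phi psi = curve_id L ->
  exists (u : {rmorphism L -> K}) (w : {rmorphism K -> L}),
    [/\ pullback phi = u, forall e, u (ff_const L e) = ff_const K e,
        forall e, w (ff_const K e) = ff_const L e, cancel u w & cancel w u].
Proof.
move=> /pullback_compK wK /pullback_compK uK.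
have [u eu] := pullback_rmorphism phi; have [w ew] := pullback_rmorphism psi.
exists u, w; rewrite -eu -ew; split=> //; exact: pullback_const.
Qed.

(* Regularity only gives that O_(phi P) is contained in the preimage of O_P; applying it to the
   inverse as well forces equality. *)
Lemma local_ring_iso K L (phi : curve_hom K L) (psi : curve_hom L K) P :
  curve_comp psi phi = curve_id K -> curve_comp phi psi = curve_id L ->
  local_ring (phi P) = [set f | local_ring P (pullback phi f)].
Proof.
move=> psiK phiK; apply/seteqP; split=> f /=; first exact: local_ring_pullback.
have pK : psi (phi P) = P by exact: (congr1 (fun h : curve_hom K K => on_points h P) psiK).
rewrite -[X in local_ring X _ -> _]pK => /local_ring_pullback.
by rewrite (pullback_compK phiK).
Qed.

(** An automorphism has an inverse, so [local_ring_iso] recovers its map on points from its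
    pullback. *)
Lemma curve_aut_ext K (phi psi : curve_aut K) : pullback phi = pullback psi -> phi = psi.
Proof.
move=> e; apply: curve_aut_eq; apply: curve_hom_eq => //; apply: funext => P.
apply: curve_point_eq; rewrite (local_ring_iso P (aut_homK phi) (aut_inv_homK phi)).
by rewrite (local_ring_iso P (aut_homK psi) (aut_inv_homK psi)) e.
Qed.

Lemma curve_iso_of_rmorphism K L (u : {rmorphism L -> K}) (w : {rmorphism K -> L}) :
  (forall e, u (ff_const L e) = ff_const K e) -> (forall e, w (ff_const K e) = ff_const L e) ->
  cancel u w -> cancel w u ->
  exists (phi : curve_hom K L) (psi : curve_hom L K),
    [/\ pullback phi = u, curve_comp psi phi = curve_id K & curve_comp phi psi = curve_id L].
Proof.
move=> uC wC uK wK; have [phi [ephi Ophi]] := curve_hom_of_rmorphism uC.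
have [psi [epsi Opsi]] := curve_hom_of_rmorphism wC.
exists phi, psi; split=> //; apply: curve_hom_eq; apply: funext => P /=.
- by apply: curve_point_eq; rewrite Opsi Ophi; apply: funext => f /=; rewrite wK.
- by rewrite ephi epsi wK.
- by apply: curve_point_eq; rewrite Ophi Opsi; apply: funext => f /=; rewrite uK.
- by rewrite ephi epsi uK.
Qed.

Lemma curve_aut_of_rmorphism K (u w : {rmorphism K -> K}) :
  (forall e, u (ff_const K e) = ff_const K e) -> (forall e, w (ff_const K e) = ff_const K e) ->
  cancel u w -> cancel w u -> exists phi : curve_aut K, pullback phi = u.
Proof.
move=> uC wC uK wK; have [phi [psi [e h1 h2]]] := curve_iso_of_rmorphism uC wC uK wK.
by exists (CurveAut h1 h2).
Qed.

End CurveHoms.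

(** * Isomorphism classes, and the shape of automorphisms *)

Local Open Scope classical_set_scope.

Lemma shift_eq1F (k : fieldType) : (shift k == 1%g) = false.
Proof. exact/eqP/shift_neq1. Qed.

(** Meant for [beta] equal to 0 or 1, where it is the transformation x + beta; any other value
    yields [shift] by default. *)
Definition translation (k : fieldType) (beta : k) : PGL2 k :=
  if beta == 0 then 1%g else shift k.

Lemma moebius_translation (k : fieldType) (beta : k) : (beta == 0) || (beta == 1) ->
  moebius (translation beta) = ratx k + ratC beta.
Proof.
move=> /orP[] /eqP->; rewrite /translation ?eqxx ?oner_eq0.
  by rewrite moebius1 /ratC polyC0 tofrac0 addr0.
by rewrite moebius_shift /ratC polyC1 tofrac1 addrC.
Qed.

Section Classification.
Context {k : fieldType} (k2 : 2%N \in [pchar k]) (r : k) (r_notin_AS : ~~ AS k2 r).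
Implicit Types n : calN k2.
Local Notation X n e := (coord_x r (Nb n) (Nc n) e (Na_neq0 n)).
Local Notation Y n e := (coord_y r (Nb n) (Nc n) e (Na_neq0 n)).
Local Notation ofr n e := (of_ratfun r (Nb n) (Nc n) e (Na_neq0 n)).

Lemma curve_iso_shape n n' (e e' : k)
    (phi : curve_hom (curve_of r n' e') (curve_of r n e))
    (psi : curve_hom (curve_of r n e) (curve_of r n' e')) :
  curve_comp psi phi = curve_id (curve_of r n' e') ->
  curve_comp phi psi = curve_id (curve_of r n e) ->
  exists beta v : k,
    [/\ (beta == 0) || (beta == 1), pullback phi (X n e) = ofr n' e' (ratx k + ratC beta),
        pullback phi (Y n e) = Y n' e' + ofr n' e' (ratC v) &
        [/\ Na n = Na n', Nb n = Nb n', Nb n * beta + Nc n = Nc n' &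
            Na n * beta + e - e' = v + v ^+ 2]].
Proof.
move=> psiK phiK; have [u [w [-> uC wC wu uw]]] := curve_iso_rmorphism psiK phiK.
(* Rationality is first applied to the inverse: w(x_K) is a rational function g of x_L, so u(g) =
   x_K as [iso_shape] requires. *)
have [g eg] := image_x_rational r_notin_AS (Nbc_neq0 n) wC (wu (X n e)).
have ug : u (ofr n e g) = X n' e'.
  exact (etrans (f_equal u (esym eg)) (uw _)).
exact (iso_shape r_notin_AS (Nbc_neq0 n') uC ug (uw (Y n' e'))).
Qed.

Lemma Nact_translation n n' (e e' beta v : k) :
  AS_class k2 e = Nd n -> AS_class k2 e' = Nd n' -> (beta == 0) || (beta == 1) ->
  Na n = Na n' -> Nb n = Nb n' -> Nb n * beta + Nc n = Nc n' ->
  Na n * beta + e - e' = v + v ^+ 2 -> n' = Nact n (translation beta).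
Proof.
move=> en en' beta01 ea eb ec ev.
have ed : Nd n' = AS_class k2 (Na n * beta + e).
  by rewrite -en'; apply/esym/AS_class_eq/ASP; exists v.
move: beta01 ec ed => /orP[] /eqP->; rewrite /translation ?eqxx ?oner_eq0.
  rewrite !mulr0 !add0r Nact1 => ec ed.
  by apply: calN_eq => //; rewrite ed.
rewrite !mulr1 => ec ed; rewrite /Nact shift_eq1F; apply: calN_eq => //=.
by rewrite ed AS_classD addrC en.
Qed.

Lemma Nact_translationP n n' (e e' beta : k) :
  AS_class k2 e = Nd n -> AS_class k2 e' = Nd n' -> (beta == 0) || (beta == 1) ->
  n' = Nact n (translation beta) ->
  exists v, [/\ Na n = Na n', Nb n = Nb n', Nb n * beta + Nc n = Nc n' &
                Na n * beta + e - e' = v + v ^+ 2].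
Proof.
move=> en en' beta01 en'n.
have [ea eb ec ed] : [/\ Na n = Na n', Nb n = Nb n', Nb n * beta + Nc n = Nc n' &
    AS_class k2 (Na n * beta + e) = Nd n'].
  move: beta01 en'n => /orP[] /eqP->; rewrite /translation ?eqxx ?oner_eq0.
    by rewrite Nact1 => ->; rewrite !mulr0 !add0r.
  rewrite /Nact shift_eq1F => ->; rewrite !mulr1 /=; split=> //.
  by rewrite AS_classD en addrC.
move: ed; rewrite -en' => /AS_class_eq/ASP[v ev].
by exists v.
Qed.

Lemma curves_isomorphic n n' (e e' : k) :
  AS_class k2 e = Nd n -> AS_class k2 e' = Nd n' ->
  k_isomorphic (curve_of r n' e') (curve_of r n e) <->
  exists g : PGL2 k, Gamma k g /\ n' = Nact n g.
Proof.
move=> en en'; split=> [[phi [psi [psiK phiK]]]|[g [Gg en'n]]].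
  have [beta [v [beta01 _ _ [ea eb ec ev]]]] := curve_iso_shape psiK phiK.
  exists (translation beta); split; last exact: Nact_translation en en' beta01 ea eb ec ev.
  by rewrite /translation; case: ifP; [left|right].
have [beta [beta01 eg]] : exists beta : k, (beta == 0) || (beta == 1) /\ g = translation beta.
  case: Gg => ->; [exists 0|exists 1]; rewrite /translation ?eqxx ?oner_eq0 ?orbT //.
rewrite eg in en'n; have [v [ea eb ec ev]] := Nact_translationP en en' beta01 en'n.
have [u [w [uC _ _ [wC uK wK]]]] :=
  Kabcd_shift_iso k2 r (Na_neq0 n) (Na_neq0 n') beta01 ea eb ec ev.
have [phi [psi [_ psiK phiK]]] :=
  @curve_iso_of_rmorphism k (curve_of r n' e') (curve_of r n e) u w uC wC uK wK.
by exists phi, psi.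
Qed.

Section Aut.
Context (n : calN k2) (e : k) (en : AS_class k2 e = Nd n).
Local Notation C := (curve_of r n e).
Local Notation x := (coord_x r (Nb n) (Nc n) e (Na_neq0 n)).
Local Notation y := (coord_y r (Nb n) (Nc n) e (Na_neq0 n)).
Local Notation of_k := (const_abcd r (Nb n) (Nc n) e (Na_neq0 n)).

Lemma aut_shape (phi : curve_aut C) : exists beta v : k,
  [/\ (beta == 0) || (beta == 1), pullback phi x = x + of_k beta,
      pullback phi y = y + of_k v, Na n * beta = v + v ^+ 2 & n = Nact n (translation beta)].
Proof.
have [beta [v [beta01 ex ey [ea eb ec ev]]]] := curve_iso_shape (aut_homK phi) (aut_inv_homK phi).
exists beta, v; split=> //.
- by rewrite ex; exact: rmorphD (ofr n e) _ _.
- by rewrite -ev addrK.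
- exact: Nact_translation en en beta01 ea eb ec ev.
Qed.

Lemma aut_exists (beta v : k) : (beta == 0) || (beta == 1) ->
  Nb n * beta = 0 -> Na n * beta = v + v ^+ 2 ->
  exists phi : curve_aut C, pullback phi x = x + of_k beta /\ pullback phi y = y + of_k v.
Proof.
move=> beta01 eb ev.
have ec : Nb n * beta + Nc n = Nc n by rewrite eb add0r.
have ed : Na n * beta + e - e = v + v ^+ 2 by rewrite addrK.
have [u [w [uC ux uy [wC uK wK]]]] :=
  Kabcd_shift_iso k2 r (Na_neq0 n) (Na_neq0 n) beta01 erefl erefl ec ed.
have [phi ephi] := @curve_aut_of_rmorphism k C u w uC wC uK wK.
by exists phi; rewrite ephi.
Qed.

Lemma aut_ext (phi psi : curve_aut C) :
  pullback phi x = pullback psi x -> pullback phi y = pullback psi y -> phi = psi.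
Proof.
move=> exy eyy; apply: curve_aut_ext; apply: funext.
have [u eu] := pullback_rmorphism phi; have [w ew] := pullback_rmorphism psi.
rewrite eu ew; apply: Kabcd_ext => [t||]; last 2 first.
- by rewrite -eu -ew.
- by rewrite -eu -ew.
by rewrite -eu -ew; exact: etrans (pullback_const phi t) (esym (pullback_const psi t)).
Qed.

(** Pullback reverses composition, but translations by constants commute. *)
Lemma pullback_aut_mul (phi psi : curve_aut C) (z : Kabcd r (Nb n) (Nc n) e (Na_neq0 n)) (s t : k) :
  pullback phi z = z + of_k s -> pullback psi z = z + of_k t ->
  pullback (phi * psi)%g z = z + of_k (s + t).
Proof.
move=> ephi epsi; have [w ew] := pullback_rmorphism psi.
have -> : pullback (phi * psi)%g z = w (pullback phi z) by rewrite -ew.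
rewrite ephi; apply: (etrans (rmorphD w _ _)).
have -> : w z = z + of_k t by rewrite -ew.
have -> : w (of_k s) = of_k s by rewrite -ew; exact: (pullback_const psi s).
by rewrite rmorphD addrA addrAC.
Qed.

End Aut.
End Classification.

(** * The split exact sequence and the isotropy group *)

Local Open Scope classical_set_scope.


Section AutSequence.
Context {k : fieldType} (k2 : 2%N \in [pchar k]) (r : k) (r_notin_AS : ~~ AS k2 r).
Context (n : calN k2) (e : k) (en : AS_class k2 e = Nd n).
Local Notation C := (curve_of r n e).
Local Notation x := (coord_x r (Nb n) (Nc n) e (Na_neq0 n)).
Local Notation y := (coord_y r (Nb n) (Nc n) e (Na_neq0 n)).
Local Notation of_k := (const_abcd r (Nb n) (Nc n) e (Na_neq0 n)).

(** By [aut_shape] the pullback of x is x or x + 1, so testing whether x is fixed determines the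
    induced transformation. *)
Definition aut_on_line (phi : curve_aut C) : PGL2 k :=
  if pullback phi x == x then 1%g else shift k.

Lemma aut_on_lineE (phi : curve_aut C) (beta : k) :
  pullback phi x = x + of_k beta -> aut_on_line phi = translation beta.
Proof.
move=> ex; rewrite /aut_on_line ex /translation -(subr_eq0 _ x) addrAC subrr add0r.
by rewrite fmorph_eq0.
Qed.

(** Fixing the third coordinate means b + c = c; fixing the fourth means that the class of a in
    k/AS(k) is zero. *)
Lemma shift_isotropy : isotropy n (shift k) <-> Nb n = 0 /\ AS k2 (Na n).
Proof.
have es m : Nact m (shift k) = m <-> Nb m + Nc m = Nc m /\ Nd m + AS_class k2 (Na m) = Nd m.
  rewrite /Nact shift_eq1F; split=> [em|[ec ed]]; last exact: calN_eq.
  by split; [rewrite -[in RHS]em|rewrite -[in RHS]em].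
split=> [[_ /es[ec ed]]|[eb /ASP[v ev]]].
  split; first by apply: (addIr (Nc n)); rewrite add0r.
  have : AS_class k2 (Na n) = AS_class k2 0.
    by apply: (addrI (Nd n)); rewrite ed -en -AS_classD addr0.
  by move/AS_class_eq; rewrite subr0.
split; first by right.
apply/es; rewrite eb add0r; split=> //; rewrite -en -AS_classD; apply/AS_class_eq/ASP.
by exists v; rewrite addrC addKr.
Qed.

Lemma isotropy1 : isotropy n 1%g.
Proof. by split; [left|rewrite Nact1]. Qed.

Lemma aut_on_lineM : {morph aut_on_line : f g / (f * g)%g}.
Proof.
move=> f g; have [bf [_ [bf01 ef _ _ _]]] := aut_shape r_notin_AS en f.
have [bg [_ [bg01 eg _ _ _]]] := aut_shape r_notin_AS en g.
rewrite (aut_on_lineE ef) (aut_on_lineE eg) (aut_on_lineE (pullback_aut_mul ef eg)).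
move: bf01 bg01 => /orP[] /eqP-> /orP[] /eqP->;
  rewrite /translation ?(addr0, add0r, addrr_pchar2 k2) ?eqxx ?oner_eq0.
- by rewrite mulg1.
- by rewrite mul1g.
- by rewrite mulg1.
- by rewrite shift_mulK.
Qed.

Lemma aut_split_exact : exists (iota : curve_aut C) (rho : curve_aut C -> PGL2 k),
  is_map iota 1%g 1 /\ (forall phi, exists v : {fraction {poly k}}, is_map phi (rho phi) v) /\
  split_exact (cyclic_subgroup iota) rho (isotropy n).
Proof.
have zero01 : ((0 : k) == 0) || ((0 : k) == 1) by rewrite eqxx.
have one01 : ((1 : k) == 0) || ((1 : k) == 1) by rewrite eqxx orbT.
have [iota [ix iy]] : exists phi : curve_aut C,
    pullback phi x = x + of_k 0 /\ pullback phi y = y + of_k 1.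
  by apply: aut_exists => //; rewrite mulr0 // expr1n (addrr_pchar2 k2).
have rho_iota : aut_on_line iota = 1%g by rewrite (aut_on_lineE ix) /translation eqxx.
have rho1 : aut_on_line 1%g = 1%g.
  have x0 : pullback (1%g : curve_aut C) x = x + of_k 0 by rewrite rmorph0 addr0.
  by rewrite (aut_on_lineE x0) /translation eqxx.
exists iota, aut_on_line; split; [|split].
- split; first by rewrite ix rmorph0 addr0 moebius1.
  by rewrite iy; congr (_ + _); rewrite /const_abcd /ratC polyC1 tofrac1.
- move=> phi; have [beta [v [beta01 ex ey _ _]]] := aut_shape r_notin_AS en phi.
  exists (ratC v); split; last exact: ey.
  rewrite ex (aut_on_lineE ex) moebius_translation //; exact/esym/rmorphD.
split.
- exact: aut_on_lineM.
- apply/seteqP; split=> phi /=.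
    have [beta [v [beta01 ex ey ev _]]] := aut_shape r_notin_AS en phi.
    rewrite (aut_on_lineE ex) /translation; case: eqP => [b0 _|_ /eqP]; last by rewrite shift_eq1F.
    (* With beta = 0 the equation reads v + v^2 = 0: v = 0 is the identity and v = 1 is [iota],
       whence the exponents 0 and 1. *)
    have : v * (v + 1) == 0 by rewrite mulrDr mulr1 addrC -expr2 -ev b0 mulr0.
    rewrite mulf_eq0 addr_eq0 (oppr_pchar2 k2) => /orP[] /eqP v01.
      exists 0%N; left; apply: aut_ext.
        by rewrite ex b0 rmorph0 addr0.
      by rewrite ey v01 rmorph0 addr0.
    exists 1%N; left; apply: aut_ext.
      by rewrite ex b0 expg1 ix.
    by rewrite ey v01 expg1 iy.
  have rhoX m : aut_on_line (iota ^+ m)%g = 1%g.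
    by elim: m => [|m IHm]; rewrite ?expg0 // expgS aut_on_lineM rho_iota IHm mulg1.
  case=> m [] -> //; have := aut_on_lineM (iota ^+ m)%g (iota ^- m)%g.
  by rewrite mulgV rho1 rhoX mul1g.
- apply/seteqP; split=> [_ [phi _ <-]|g [Gg ng]].
    have [beta [v [beta01 ex _ _ en']]] := aut_shape r_notin_AS en phi.
    rewrite (aut_on_lineE ex); split; last exact: esym.
    by rewrite /translation; case: ifP; [left|right].
  case: Gg ng => -> ng; first by exists 1%g.
  have /shift_isotropy[eb /ASP[v ev]] : isotropy n (shift k) by split; [right|].
  have [phi [ex _]] : exists phi : curve_aut C,
      pullback phi x = x + of_k 1 /\ pullback phi y = y + of_k v.
    by apply: aut_exists => //; rewrite ?eb ?mul0r ?mulr1.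
  by exists phi => //; rewrite (aut_on_lineE ex) /translation oner_eq0.
(* If [shift] fixes the parameters, a = v + v^2 and (x, y) -> (x + 1, y + v) with v constant is a
   lift of order 2, which splits the sequence; otherwise the quotient is trivial. *)
have [/shift_isotropy[eb /ASP[v ev]]|ns] := pselect (isotropy n (shift k)).
  have [phi [ex ey]] : exists phi : curve_aut C,
      pullback phi x = x + of_k 1 /\ pullback phi y = y + of_k v.
    by apply: aut_exists => //; rewrite ?eb ?mul0r ?mulr1.
  have phi2 : (phi * phi = 1)%g.
    apply: aut_ext.
      by rewrite (pullback_aut_mul ex ex) (addrr_pchar2 k2) rmorph0 addr0.
    by rewrite (pullback_aut_mul ey ey) (addrr_pchar2 k2) rmorph0 addr0.
  exists (fun g => if g == 1%g then 1%g else phi); split=> [g h [+ _] [+ _]|g [+ _]].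
    by move=> [->|->] [->|->]; rewrite ?mulg1 ?mul1g ?shift_mulK // ?eqxx ?shift_eq1F ?mulg1 ?mul1g.
  move=> [->|->]; rewrite ?eqxx ?shift_eq1F //.
  by rewrite (aut_on_lineE ex) /translation oner_eq0.
have iso1 g : isotropy n g -> g = 1%g by move=> [[->|->]] // sn; case: ns; split; [right|].
by exists (fun => 1%g); split=> [g h _ _|g /iso1->]; rewrite ?mulg1.
Qed.

Lemma isotropy_C2 : Nb n = 0 /\ AS k2 (Na n) -> subgroup_isog C2 (isotropy n).
Proof.
move=> /shift_isotropy sn; suff -> : isotropy n = Gamma k by exact: Gamma_isog_C2.
by apply/seteqP; split=> g; [case | case=> ->; [exact: isotropy1 | exact: sn]].
Qed.

Lemma isotropy_trivial : ~ (Nb n = 0 /\ AS k2 (Na n)) -> isotropy n = [set 1%g].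
Proof.
move=> nb; apply/seteqP; split=> [g [[->|->]] // sn|g ->]; last exact: isotropy1.
by case: nb; apply/shift_isotropy; split; [right|].
Qed.

End AutSequence.

Theorem proposition9 (k : fieldType) (k2 : 2%N \in [pchar k])
    (k_perfect : perfect_field k) (r : k) (r_notin_AS : ~~ AS k2 r) :
  (forall (n n' : calN k2) (e e' : k),
     AS_class k2 e = Nd n -> AS_class k2 e' = Nd n' ->
     k_isomorphic (curve_of r n' e') (curve_of r n e) <->
     exists g : PGL2 k, Gamma k g /\ n' = Nact n g) /\
  (forall (n : calN k2) (e : k), AS_class k2 e = Nd n ->
     (exists (iota : curve_aut (curve_of r n e))
             (rho : curve_aut (curve_of r n e) -> PGL2 k),
        is_map iota 1%g 1 /\
        (forall phi, exists v : {fraction {poly k}}, is_map phi (rho phi) v) /\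
        split_exact (cyclic_subgroup iota) rho (isotropy n)) /\
     ((Nb n = 0 /\ AS k2 (Na n)) -> subgroup_isog C2 (isotropy n)) /\
     (~ (Nb n = 0 /\ AS k2 (Na n)) -> isotropy n = [set 1%g])).
Proof.
split=> [n n' e e' en en'|n e en]; first exact: curves_isomorphic.
split; first exact: aut_split_exact.
split; [exact: isotropy_C2 en | exact: isotropy_trivial en].
Qed.
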